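(* Let $R$ be a finite chain ring of length $2$ with residue field $\mathbb{F}_q$, where $q\ge5$ is a prime power. Then $$\mathrm{m}_3(R)\le\begin{cases}2q^2-2q+4 & \text{if } q \text{ is odd},\\ 2q^2-q+4 & \text{if } q \text{ is even}.\end{cases}$$
   Context: Throughout, $R$ is a finite chain ring of nilpotency index (length) $2$, i.e. a finite local ring with radical $\mathrm{rad}R\neq 0$, $(\mathrm{rad}R)^2=0$, whose one-sided ideals form the chain $R\supsetneq\mathrm{rad}R\supsetneq 0$, with residue field $R/\mathrm{rad}R\cong\mathbb{F}_q$ ($q$ a prime power); then $|R|=q^2$. The projective Hjelmslev plane $\mathrm{PHG}(2,R)$ is the incidence structure whose points are the free rank-$1$ submodules of the right module $R_R^3$, whose lines are the free rank-$2$ submodules of $R_R^3$, with incidence given by inclusion; it has $q^4+q^3+q^2$ points and each line contains $q^2+q$ points. A $(k,n)$-arc is a map $\mathcal{K}$ from the point set to $\mathbb{N}_0$ with $\sum_x\mathcal{K}(x)=k$ and $\sum_{x\in L}\mathcal{K}(x)\le n$ for every line $L$; it is projective if $\mathcal{K}$ takes only values in $\{0,1\}$ (i.e. it is a set of $k$ points meeting every line in at most $n$ points). For $0\le n\le q^2+q$, $\mathrm{m}_n(R)$ denotes the largest $k$ such that a projective $(k,n)$-arc exists in $\mathrm{PHG}(2,R)$. *)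

(* Defs.v *)
From HB Require Import structures.
From mathcomp Require Import all_boot all_order all_algebra.
Set Implicit Arguments. Unset Strict Implicit. Unset Printing Implicit Defensive.
Import GRing.Theory.
Local Open Scope ring_scope.

Section Defs.
Variable R : finNzRingType.

Definition is_rideal (I : {set R}) : bool :=
  (0 \in I) && [forall x, forall y, (x \in I) ==> (y \in I) ==> (x - y \in I)]
  && [forall x, forall r, (x \in I) ==> (x * r \in I)].
Definition is_lideal (I : {set R}) : bool :=
  (0 \in I) && [forall x, forall y, (x \in I) ==> (y \in I) ==> (x - y \in I)]
  && [forall x, forall r, (x \in I) ==> (r * x \in I)].

Definition is_max_rideal (I : {set R}) : bool :=
  is_rideal I && (I != setT) &&
  [forall K : {set R}, (is_rideal K && (I \subset K)) ==> ((K == I) || (K == setT))].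

Definition jrad : {set R} := \bigcap_(I : {set R} | is_max_rideal I) I.

Definition chain_ring_len2 : Prop :=
  jrad != [set 0] /\
  (forall I : {set R}, is_rideal I = (I \in [set setT; jrad; [set 0]])) /\
  (forall I : {set R}, is_lideal I = (I \in [set setT; jrad; [set 0]])).

Definition rmul (x : 'rV[R]_3) (r : R) : 'rV[R]_3 := \row_j (x 0 j * r).

Definition comb (k : nat) (b : {ffun 'I_k -> 'rV[R]_3}) (c : {ffun 'I_k -> R})
  : 'rV[R]_3 := \sum_(i < k) rmul (b i) (c i).

Definition free_submod (k : nat) (M : {set 'rV[R]_3}) : bool :=
  [exists b : {ffun 'I_k -> 'rV[R]_3},
     injectiveb (comb b) && (M == [set comb b c | c : {ffun 'I_k -> R}])].

Definition is_point (M : {set 'rV[R]_3}) : bool := free_submod 1 M.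
Definition is_line (M : {set 'rV[R]_3}) : bool := free_submod 2 M.

Definition proj_arc (n : nat) (S : {set {set 'rV[R]_3}}) : bool :=
  [forall x in S, is_point x] &&
  [forall L : {set 'rV[R]_3}, is_line L ==>
     (#|[set x in S | x \subset L]| <= n)%N].

Definition m_arc (n : nat) : nat :=
  \max_(S : {set {set 'rV[R]_3}} | proj_arc n S) #|S|.

End Defs.

(* Main.v *)
Require Import Defs.
From HB Require Import structures.
From mathcomp Require Import all_boot all_order all_algebra all_field.
From mathcomp Require Import mxabelem zify.
Set Implicit Arguments. Unset Strict Implicit. Unset Printing Implicit Defensive.
Import GRing.Theory.

(** Reduce modulo the radical [J].  The points of the arc fall into the
    neighbour classes, which are the points [x] of the plane PG(2,q) over the
    residue field [F]; inside a class they form a set of [wt x] points of an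
    affine plane AG(2,q), whose parallel classes are the lines [l] of PG(2,q)
    through [x].  The [q] lines of the Hjelmslev plane in the class [l] that
    contain a given segment [s] of [x] partition the points over [l] outside
    [x], hence the total weight of [l] is at most [wt x + q * (3 - #|s|)].
    Summed over the lines through [x] this gives
    [k <= wt x + 3 * q * (q + 1) - q * e], where [e] is the sum over the
    directions of the maximal segment size.  As [e >= q + wt x], with equality
    only if in each direction all nonempty segments have the same size, a class
    of weight at least 4 suffices; four points with only three directions are
    an affine Fano configuration, which does not exist for odd [q].

    If all classes have weight at most 3, then a line of PG(2,q) carries a
    segment with two points in at most one of its classes, because two such
    segments would span a line with four points.  These lines have small
    weight, and comparing with the second moment of the line weights bounds
    [k], except when [q = 5] and some class consists of three noncollinear
    points.  In that case a line through the class without a doubled segment has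
    weight at most 11 (it is dual to a (12,3)-arc of PG(2,5), which is excluded
    by counting its 2-secants), and the pencil of the class gives [k <= 44]. *)

(** * The residue ring modulo a two-sided ideal, and why it is a field *)

Section ResidueField.

Local Open Scope ring_scope.

Variables (R : finNzRingType) (J : {set R}).
Hypothesis J0 : 0 \in J.
Hypothesis JB : forall x y, x \in J -> y \in J -> x - y \in J.
Hypothesis JMr : forall x y, x \in J -> x * y \in J.
Hypothesis JMl : forall x y, y \in J -> x * y \in J.
Hypothesis J1 : 1 \notin J.
Hypothesis Junit : forall x, x \notin J -> exists y, y * x = 1 /\ x * y = 1.

Let JN x : x \in J -> - x \in J.
Proof. by move=> xJ; rewrite -sub0r JB. Qed.

Let JD x y : x \in J -> y \in J -> x + y \in J.
Proof. by move=> xJ yJ; rewrite -[y]opprK JB // JN. Qed.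

(** [pick] sees only the coset of [x], so congruent elements share a representative and the fixed
    points can carry the residue ring. The default is never taken, as [x - x] lies in [J]. *)
Definition residue_repr (x : R) : R := odflt x [pick y | x - y \in J].

Let rJ x : x - residue_repr x \in J.
Proof.
rewrite /residue_repr; case: pickP => [y //|]; move/(_ x).
by rewrite subrr J0.
Qed.

Let repr_eq x y : x - y \in J -> residue_repr x = residue_repr y.
Proof.
move=> xy; rewrite /residue_repr.
have e : (fun z => x - z \in J) =1 (fun z => y - z \in J).
  move=> z; apply/idP/idP => h.
    have -> : y - z = (x - z) - (x - y) by rewrite opprB [RHS]addrC subrKA.
    exact: JB.
  have -> : x - z = (x - y) + (y - z) by rewrite subrKA.
  exact: JD.
rewrite (eq_pick e); case: pickP => // /(_ y); by rewrite subrr J0.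
Qed.

Let repr_id x : residue_repr (residue_repr x) = residue_repr x.
Proof. by apply/esym/repr_eq. Qed.

Definition residue := {x : R | residue_repr x == x}.

HB.instance Definition _ := Finite.on residue.

Definition to_residue (x : R) : residue :=
  exist _ (residue_repr x) (introT eqP (repr_id x)).

Let to_eq x y : to_residue x = to_residue y <-> x - y \in J.
Proof.
split=> [/(congr1 val) /= e|xy]; last by apply: val_inj; apply: repr_eq.
have -> : x - y = (x - residue_repr x) - (y - residue_repr y).
  by rewrite e opprB addrA subrK.
exact: JB.
Qed.

Let to_val (a : residue) : to_residue (val a) = a.
Proof. by apply: val_inj => /=; apply/eqP/(valP a). Qed.

Let toJ x y : x - y \in J -> to_residue x = to_residue y.
Proof. by move/to_eq. Qed.

Let zero_ := to_residue 0.
Let one_ := to_residue 1.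
Let opp_ (a : residue) := to_residue (- val a).
Let add_ (a b : residue) := to_residue (val a + val b).
Let mul_ (a b : residue) := to_residue (val a * val b).

Let addE x y : add_ (to_residue x) (to_residue y) = to_residue (x + y).
Proof.
apply: toJ => /=; rewrite opprD addrACA.
by apply: JD; rewrite -opprB JN.
Qed.
Let oppE x : opp_ (to_residue x) = to_residue (- x).
Proof. by apply: toJ => /=; rewrite opprK addrC. Qed.
Let mulE x y : mul_ (to_residue x) (to_residue y) = to_residue (x * y).
Proof.
apply: toJ => /=.
have -> : residue_repr x * residue_repr y - x * y =
  (residue_repr x - x) * residue_repr y + x * (residue_repr y - y).
  by rewrite mulrBl mulrBr addrA subrK.
by apply: JD; [apply: JMr | apply: JMl]; rewrite -opprB JN.
Qed.

Let toP (P : residue -> Prop) : (forall x, P (to_residue x)) -> forall a, P a.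
Proof. by move=> h a; rewrite -(to_val a). Qed.

Let addA_ : associative add_.
Proof. by do 3!elim/toP => ?; rewrite !addE addrA. Qed.
Let addC_ : commutative add_.
Proof. by do 2!elim/toP => ?; rewrite !addE addrC. Qed.
Let add0_ : left_id zero_ add_.
Proof. by elim/toP => x; rewrite addE add0r. Qed.
Let addN_ : left_inverse zero_ opp_ add_.
Proof. by elim/toP => x; rewrite oppE addE addNr. Qed.
Let mulA_ : associative mul_.
Proof. by do 3!elim/toP => ?; rewrite !mulE mulrA. Qed.
Let mul1_ : left_id one_ mul_.
Proof. by elim/toP => x; rewrite mulE mul1r. Qed.
Let mulr1_ : right_id one_ mul_.
Proof. by elim/toP => x; rewrite mulE mulr1. Qed.
Let mulDl_ : left_distributive mul_ add_.
Proof. by do 3!elim/toP => ?; rewrite !(addE, mulE) mulrDl. Qed.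
Let mulDr_ : right_distributive mul_ add_.
Proof. by do 3!elim/toP => ?; rewrite !(addE, mulE) mulrDr. Qed.
Let oner_ : one_ != zero_.
Proof. by apply/eqP => /to_eq; rewrite subr0 (negbTE J1). Qed.

HB.instance Definition _ := GRing.isZmodule.Build residue addA_ addC_ add0_ addN_.
HB.instance Definition _ :=
  GRing.Zmodule_isNzRing.Build residue mulA_ mul1_ mulr1_ mulDl_ mulDr_ oner_.

Let unit_ : pred residue := fun a => a != 0.
(** The default makes a non-invertible element its own inverse, as the unit ring interface
    demands. *)
Let inv_ (a : residue) : residue := odflt a [pick b | (b * a == 1) && (a * b == 1)].

Let inv_P (a : residue) : a != 0 -> inv_ a * a = 1 /\ a * inv_ a = 1.
Proof.
move=> a0; rewrite /inv_; case: pickP => [b /andP[/eqP ? /eqP ?]//|].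
have /Junit [y [yx xy]] : val a \notin J.
  apply: contra a0 => aJ; rewrite -(to_val a); apply/eqP/to_eq.
  by rewrite subr0.
have ea : to_residue y * a = 1.
  by rewrite -{1}(to_val a); apply: (etrans (mulE _ _)); rewrite yx.
have eb : a * to_residue y = 1.
  by rewrite -{1}(to_val a); apply: (etrans (mulE _ _)); rewrite xy.
by move/(_ (to_residue y)); rewrite ea eb !eqxx.
Qed.
Let mulV_ : {in unit_, left_inverse 1 inv_ *%R}.
Proof. by move=> a /inv_P[]. Qed.
Let mulrV_ : {in unit_, right_inverse 1 inv_ *%R}.
Proof. by move=> a /inv_P[]. Qed.
Let unitP_ (a b : residue) : b * a = 1 /\ a * b = 1 -> unit_ a.
Proof.
by case=> ba _; apply/eqP => a0; move: ba; rewrite a0 mulr0 => /esym/eqP; rewrite oner_eq0.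
Qed.
Let inv_out : {in [predC unit_], inv_ =1 id}.
Proof.
move=> a; rewrite inE /= => na; rewrite /inv_; case: pickP => // b /andP[/eqP ? /eqP ?].
by case/negP: na; apply: (@unitP_ a b).
Qed.
HB.instance Definition _ :=
  GRing.NzRing_hasMulInverse.Build residue mulV_ mulrV_ unitP_ inv_out.

Let dom_ : GRing.integral_domain_axiom residue.
Proof.
move=> a b ab; apply: contraT; rewrite negb_or => /andP[a0 b0].
have [/= va _] := inv_P a0; case/eqP: b0.
by rewrite -[b]mul1r -va -mulrA ab mulr0.
Qed.

(** Commutativity comes from Wedderburn's theorem: nonzero residues are invertible, so the residue
    ring is a finite domain, and [FinDomainFieldType] makes it a field. *)
Lemma residue_field : exists (F : finFieldType) (pi : R -> F),
  [/\ {morph pi : x y / x + y}, {morph pi : x y / x * y},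
      (forall x, (pi x == 0) = (x \in J)) & (forall a, exists x, pi x = a)].
Proof.
exists (FinDomainFieldType dom_), (to_residue : R -> FinDomainFieldType dom_); split.
- by move=> x y; apply/esym/addE.
- by move=> x y; apply/esym/mulE.
- by move=> x; apply/eqP/idP => [/to_eq|xJ]; [rewrite subr0 | apply/to_eq; rewrite subr0].
- by move=> a; exists (val a); apply: to_val.
Qed.

End ResidueField.

(** * Points and lines of PG(2,q) as normalised vectors, and incidence counts *)

Section ProjectivePlane.

Local Open Scope ring_scope.

Variable F : finFieldType.
Implicit Types u v : 'rV[F]_3.

Definition dot u v : F := (u *m v^T) 0 0.

Lemma dotE u v : dot u v = \sum_i u 0 i * v 0 i.
Proof. by rewrite /dot mxE; apply: eq_bigr => i _; rewrite mxE. Qed.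

Lemma dotC u v : dot u v = dot v u.
Proof. by rewrite !dotE; apply: eq_bigr => i _; rewrite mulrC. Qed.

Lemma dotBr u v1 v2 : dot u (v1 - v2) = dot u v1 - dot u v2.
Proof. by rewrite /dot linearB mulmxBr !mxE. Qed.

Lemma dotDl u1 u2 v : dot (u1 + u2) v = dot u1 v + dot u2 v.
Proof. by rewrite /dot mulmxDl mxE. Qed.

Lemma dotBl u1 u2 v : dot (u1 - u2) v = dot u1 v - dot u2 v.
Proof. by rewrite dotC dotBr !(dotC v). Qed.

Lemma dotZl a u v : dot (a *: u) v = a * dot u v.
Proof. by rewrite /dot -scalemxAl mxE. Qed.

Lemma dot_eq0 u v : (dot u v == 0) = (u *m v^T == 0).
Proof.
apply/eqP/eqP => [e|]; last by rewrite /dot => ->; rewrite mxE.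
by rewrite [LHS]mx11_scalar -/(dot u v) e raddf0.
Qed.

Definition pivot v : 'I_3 := odflt ord0 [pick i | v 0 i != 0].

Lemma pivotP v : v != 0 -> v 0 (pivot v) != 0.
Proof.
move=> v0; rewrite /pivot; case: pickP => // h; case/eqP: v0.
by apply/rowP => i; rewrite mxE; apply/eqP; move: (h i); rewrite /= => /negbFE.
Qed.

Definition nrm v := (v 0 (pivot v))^-1 *: v.

Lemma nrmZ a v : a != 0 -> nrm (a *: v) = nrm v.
Proof.
move=> a0; have -> : nrm (a *: v) = (a * v 0 (pivot v))^-1 *: (a *: v).
  rewrite /nrm; have -> : pivot (a *: v) = pivot v.
    rewrite /pivot; congr (odflt _ _); apply: eq_pick => i.
    by rewrite mxE mulf_eq0 (negbTE a0).
  by rewrite mxE.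
by rewrite scalerA invfM mulrAC mulVf // mul1r.
Qed.

Lemma nrm_neq0 v : v != 0 -> nrm v != 0.
Proof. by move=> v0; rewrite scaler_eq0 negb_or v0 invr_eq0 pivotP. Qed.

Lemma nrmK v : v != 0 -> nrm (nrm v) = nrm v.
Proof. by move=> v0; rewrite nrmZ // invr_eq0 pivotP. Qed.

(* Normalised vectors represent both the points and, via [dot], the lines of
   the projective plane over [F]. *)
Definition ppoint := {v : 'rV[F]_3 | (v != 0) && (nrm v == v)}.
HB.instance Definition _ := Finite.on ppoint.

Definition inc (x y : ppoint) := dot (val x) (val y) == 0.

Lemma inc_sym : symmetric inc.
Proof. by move=> x y; rewrite /inc dotC. Qed.

Lemma ppoint_neq0 (x : ppoint) : val x != 0.
Proof. by case/andP: (valP x). Qed.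

Lemma ppoint_nrm (x : ppoint) : nrm (val x) = val x.
Proof. by apply/eqP; case/andP: (valP x). Qed.

Lemma ppoint_scale (x y : ppoint) a : val y = a *: val x -> y = x.
Proof.
move=> e; apply: val_inj; rewrite /= -ppoint_nrm e nrmZ ?ppoint_nrm //.
by apply: contraTneq (ppoint_neq0 y) => a0; rewrite e a0 scale0r negbK.
Qed.

(** Each nonzero vector of the left kernel is a unique nonzero scalar times a unique normalised
    vector. Ranks 0, 1 and 2 of [A] give the numbers of all points, of points on a line, and of
    common points of two lines. *)
Lemma card_ppoint_ker n (A : 'M[F]_(3, n)) :
  (#|[set x : ppoint | val x *m A == 0%R]| * #|F|.-1 + 1 = #|F| ^ (3 - \rank A))%N.
Proof.
have <- : #|[set v : 'rV[F]_3 | v *m A == 0]| = (#|F| ^ (3 - \rank A))%N.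
  rewrite -mxrank_ker -card_rowg; apply: eq_card => v.
  by rewrite mem_rowg inE sub_kermx.
rewrite [RHS](cardsD1 0) inE mul0mx eqxx addnC; congr (_ + _)%N.
pose E := [set v : 'rV[F]_3 | v *m A == 0] :\ 0.
pose P := setX [set x : ppoint | val x *m A == 0] [set a : F | a != 0].
have -> : #|F|.-1 = #|[set a : F | a != 0]|.
  rewrite -(cardsC1 (0 : F)); apply: eq_card => a; by rewrite !inE.
rewrite -cardsX -/P -/E.
pose f (p : ppoint * F) := p.2 *: val p.1.
have injf : {in P &, injective f}.
  move=> [x a] [y b]; rewrite !inE /f /= => /andP[_ a0] /andP[_ b0] e.
  have xy : x = y.
    apply: (@ppoint_scale y x (a^-1 * b)).
    by rewrite -scalerA -e scalerA mulVf // scale1r.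
  rewrite xy in e *; congr (_, _); apply/eqP; rewrite -subr_eq0.
  move/eqP: e; rewrite -subr_eq0 -scalerBl scaler_eq0.
  by rewrite (negbTE (ppoint_neq0 y)) orbF.
rewrite -(card_in_imset injf); apply: eq_card => v; apply/imsetP/idP.
  case=> [[x a]]; rewrite !inE /f /= => /andP[/eqP xA a0] ->.
  by rewrite scaler_eq0 negb_or a0 ppoint_neq0 -scalemxAl xA scaler0 eqxx.
rewrite !inE => /andP[v0 /eqP vA].
have nv : (nrm v != 0) && (nrm (nrm v) == nrm v) by rewrite nrm_neq0 ?nrmK ?eqxx.
exists (exist _ (nrm v) nv : ppoint, v 0 (pivot v)).
  by rewrite !inE /= -scalemxAl vA scaler0 eqxx pivotP.
by rewrite /f /= scalerA mulfV ?scale1r // pivotP.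
Qed.

Let q_gt1 : (1 < #|F|)%N.
Proof. exact: finNzRing_gt1. Qed.

Lemma card_ppoint : #|{: ppoint}| = (#|F| ^ 2 + #|F| + 1)%N.
Proof.
have := card_ppoint_ker (0 : 'M[F]_(3, 1)); rewrite mxrank0.
have -> : #|[set x : ppoint | val x *m (0 : 'M[F]_(3, 1)) == 0]| = #|{: ppoint}|.
  by apply: eq_card => x; rewrite !inE mulmx0 eqxx.
have [p ->] : exists p, #|F| = p.+2 by exists (#|F| - 2)%N; lia.
rewrite (_ : (3 - _)%N = 3%N) //= => e; apply/eqP; rewrite -(eqn_pmul2r (ltn0Sn p)).
by apply/eqP; lia.
Qed.

Lemma card_inc x : #|[set l | inc x l]| = #|F|.+1.
Proof.
have := card_ppoint_ker (val x)^T; rewrite mxrank_tr rank_rV ppoint_neq0.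
have -> : #|[set l : ppoint | val l *m (val x)^T == 0]| = #|[set l | inc x l]|.
  by apply: eq_card => l; rewrite !inE -dot_eq0 inc_sym.
have [p ->] : exists p, #|F| = p.+2 by exists (#|F| - 2)%N; lia.
rewrite (_ : (3 - _)%N = 2%N) //= => e; apply/eqP; rewrite -(eqn_pmul2r (ltn0Sn p)).
by apply/eqP; lia.
Qed.

Lemma rank_col_mx2 u v : u != 0 -> (forall a, v <> a *: u) ->
  \rank (col_mx u v) = 2%N.
Proof.
move=> u0 nuv; apply/eqP; rewrite eqn_leq rank_leq_row /= ltnNge; apply/negP => h.
have su : (u <= col_mx u v)%MS by rewrite -addsmxE addsmxSl.
have sv : (v <= col_mx u v)%MS by rewrite -addsmxE addsmxSr.
have : (col_mx u v <= u)%MS.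
  by rewrite -(geq_leqif (mxrank_leqif_sup su)) rank_rV u0.
by move/(submx_trans sv)/sub_rVP => [a /nuv].
Qed.

Lemma card_ppoint_perp2 u v : \rank (col_mx u v) = 2%N ->
  #|[set l : ppoint | (dot (val l) u == 0) && (dot (val l) v == 0)]| = 1%N.
Proof.
move=> r2; have := card_ppoint_ker (col_mx u v)^T; rewrite mxrank_tr r2.
have -> : #|[set l : ppoint | val l *m (col_mx u v)^T == 0]| =
    #|[set l : ppoint | (dot (val l) u == 0) && (dot (val l) v == 0)]|.
  apply: eq_card => l; rewrite !inE tr_col_mx mul_mx_row row_mx_eq0.
  by rewrite !dot_eq0.
have [p ->] : exists p, #|F| = p.+2 by exists (#|F| - 2)%N; lia.
rewrite (_ : (3 - _)%N = 1%N) //= => e; apply/eqP; rewrite -(eqn_pmul2r (ltn0Sn p)).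
by apply/eqP; lia.
Qed.

Lemma rank_ppoint2 (x y : ppoint) : x != y -> \rank (col_mx (val x) (val y)) = 2%N.
Proof.
move=> xy; apply: rank_col_mx2 (ppoint_neq0 x) _ => a /ppoint_scale e.
by rewrite e eqxx in xy.
Qed.

Lemma card_inc2 x y : x != y -> #|[set l | inc x l && inc l y]| = 1%N.
Proof.
move/rank_ppoint2/card_ppoint_perp2 => <-.
by apply: eq_card => l; rewrite !inE inc_sym.
Qed.

Lemma perp2_prop u v w1 w2 : \rank (col_mx u v) = 2%N -> w2 != 0 ->
  dot w1 u = 0 -> dot w1 v = 0 -> dot w2 u = 0 -> dot w2 v = 0 ->
  exists a, w1 = a *: w2.
Proof.
move=> r2 w20 a1 b1 a2 b2; pose A := kermx (col_mx u v)^T.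
have sA w' : dot w' u = 0 -> dot w' v = 0 -> (w' <= A)%MS.
  move=> /eqP a /eqP b; rewrite sub_kermx tr_col_mx mul_mx_row row_mx_eq0.
  by rewrite -!dot_eq0 a b.
have : (A <= w2)%MS.
  by rewrite -(geq_leqif (mxrank_leqif_sup (sA _ a2 b2))) mxrank_ker mxrank_tr r2 rank_rV w20.
by move/(submx_trans (sA _ a1 b1))/sub_rVP.
Qed.

(** Vectors vanishing at the pivot of [l] represent [F^3] modulo the span of [l]. A lift of [l]
    perturbed by [t] times a lift of [emb l g] will be the coefficient vector of the Hjelmslev line
    [g] in the class [l]. *)
Definition emb (l : ppoint) (g : 'rV[F]_2) : 'rV[F]_3 :=
  \row_i odflt 0 (omap (g 0) (unlift (pivot (val l)) i)).

Lemma emb_pivot l g : emb l g 0 (pivot (val l)) = 0.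
Proof. by rewrite mxE unlift_none. Qed.

Lemma emb_lift l g k : emb l g 0 (lift (pivot (val l)) k) = g 0 k.
Proof. by rewrite mxE liftK. Qed.

Lemma emb_inj l g h a : emb l g - emb l h = a *: val l -> g = h.
Proof.
move=> e; have a0 : a = 0.
  move/rowP/(_ (pivot (val l))): (e); rewrite [LHS]mxE [X in _ + X]mxE !emb_pivot subr0.
  rewrite mxE => /esym/eqP; rewrite mulf_eq0 (negbTE (pivotP (ppoint_neq0 l))) orbF.
  by move/eqP.
move: e; rewrite a0 scale0r => /eqP; rewrite subr_eq0 => /eqP e.
by apply/rowP => k; rewrite -(emb_lift l g) e emb_lift.
Qed.

(** The sign makes the two contributions of order [t] cancel at the points of class [x] on the line
    [g]. *)
Definition seg_form (l x : ppoint) (g : 'rV[F]_2) : F := - dot (emb l g) (val x).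

(** If two [g] give the same pair of values, the difference of their embeddings is orthogonal to [x]
    and [y], hence a multiple of [l], hence zero. Domain and codomain both have [q^2] elements. *)
Lemma card_seg_form l x y a b : inc l x -> inc l y -> x != y ->
  #|[set g | (seg_form l x g == a) && (seg_form l y g == b)]| = 1%N.
Proof.
move=> Ilx Ily xy; pose f g := (seg_form l x g, seg_form l y g).
have finj : injective f.
  move=> g h [/oppr_inj ex /oppr_inj ey].
  have [||||c e] := @perp2_prop _ _ (emb l g - emb l h) _ (rank_ppoint2 xy) (ppoint_neq0 l).
  - by rewrite dotBl ex subrr.
  - by rewrite dotBl ey subrr.
  - exact/eqP.
  - exact/eqP.
  exact: emb_inj e.
have [|f' fK f'K] := inj_card_bij finj; first by rewrite card_prod card_mx mul1n expnS expn1.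
apply/eqP/cards1P; exists (f' (a, b)); apply/setP => g; rewrite !inE.
rewrite -xpair_eqE -/(f g); apply/eqP/eqP => [<-|->]; by rewrite ?fK ?f'K.
Qed.

Let parallelogram0 (x l1 l2 l3 : ppoint) (e f h : 'rV[F]_3) :
  (2%:R != 0 :> F) -> inc x l1 -> inc x l2 -> inc x l3 -> l1 != l2 ->
  dot (val l1) e = 0 -> dot (val l1) h = dot (val l1) f ->
  dot (val l2) f = 0 -> dot (val l2) h = dot (val l2) e ->
  dot (val l3) h = 0 -> dot (val l3) e = dot (val l3) f ->
  dot (val l3) e = 0.
Proof.
move=> two I1 I2 I3 l12 e1 h1 f2 h2 h3 ef.
have [a [b e3]] : exists a b, val l3 = a *: val l1 + b *: val l2.
  have : (val l3 <= col_mx (val l1) (val l2))%MS.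
    have s12 : (col_mx (val l1) (val l2) <= kermx (val x)^T)%MS.
      by rewrite col_mx_sub !sub_kermx -!dot_eq0 ![dot _ (val x)]dotC -!/(inc _ _) I1 I2.
    have : (kermx (val x)^T <= col_mx (val l1) (val l2))%MS.
      rewrite -(geq_leqif (mxrank_leqif_sup s12)) rank_ppoint2 // mxrank_ker.
      by rewrite mxrank_tr rank_rV ppoint_neq0.
    by apply: submx_trans; rewrite sub_kermx -dot_eq0 dotC.
  rewrite -addsmxE => /sub_addsmxP[[u1 u2] /= ->].
  by exists (u1 0 0), (u2 0 0); rewrite {1}[u1]mx11_scalar {1}[u2]mx11_scalar !mul_scalar_mx.
move: h3 ef; rewrite e3 !dotDl !dotZl e1 h1 f2 h2 !mulr0 addr0 add0r => h3 ef.
by move/eqP: h3; rewrite -ef -mulr2n -mulr_natl mulf_eq0 (negbTE two) => /eqP.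
Qed.

(** The diagonals of a parallelogram are not parallel unless 2 = 0: [l3] is a combination of [l1]
    and [l2], as all three are orthogonal to [x], and its two equations then make twice its value at
    [d1 - d2] vanish. *)
Lemma parallelogram (x l1 l2 l3 : ppoint) (d1 d2 d3 d4 : 'rV[F]_3) :
  (2%:R != 0 :> F) -> inc x l1 -> inc x l2 -> inc x l3 -> l1 != l2 ->
  dot (val l1) d1 = dot (val l1) d2 -> dot (val l1) d3 = dot (val l1) d4 ->
  dot (val l2) d1 = dot (val l2) d3 -> dot (val l2) d2 = dot (val l2) d4 ->
  dot (val l3) d1 = dot (val l3) d4 -> dot (val l3) d2 = dot (val l3) d3 ->
  dot (val l3) (d1 - d2) = 0.
Proof.
move=> two I1 I2 I3 l12 a1 b1 a2 b2 a3 b3; apply/oppr_inj.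
rewrite oppr0 dotBr opprB -dotBr.
apply: (@parallelogram0 x l1 l2 l3 (d2 - d1) (d3 - d1) (d4 - d1)) => //; rewrite !dotBr.
- by rewrite a1 subrr.
- by rewrite b1.
- by rewrite a2 subrr.
- by rewrite b2.
- by rewrite a3 subrr.
- by rewrite b3.
Qed.

Lemma odd_card_two : odd #|F| -> 2%:R != 0 :> F.
Proof.
move=> o; apply/eqP => two.
have p2 : 2 \in [pchar F] by rewrite inE /= two eqxx.
have cF : #|F| = (2 ^ logn 2 #|F|)%N by exact: (card_pprimeChar p2).
move: o q_gt1; rewrite cF oddX orbF => /eqP ->.
by rewrite expn0.
Qed.

End ProjectivePlane.

Lemma card_set_and (A : finType) (P Q : pred A) :
  #|[set g | P g && Q g]| = \sum_(g | P g) Q g.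
Proof.
rewrite -sum1_card [LHS](eq_bigl (fun g => P g && Q g)); last first.
  by move=> g; rewrite inE.
by rewrite big_mkcondr /=; apply: eq_bigr => g _; case: (Q g).
Qed.

(** * Counting in an abstract incidence structure; classes of weight at least 4 *)

Section ArcCombinatorics.

(* [I] is the incidence of PG(2,q), with points and lines both indexed by [X];
   [c M] is the neighbour class of [M], [V l M] names the segment in direction
   [l] that contains [M], and [phi l x g] the segment of the class [x] on the
   line [g] of the line class [l]. *)
Variables (T X K L : finType) (I : rel X) (q : nat) (S : {set T}).
Variables (c : T -> X) (V : X -> T -> K) (phi : X -> X -> L -> K).

Hypothesis q5 : 5 <= q.
Hypothesis Isym : symmetric I.
Hypothesis cardX : #|X| = q ^ 2 + q + 1.
Hypothesis cardI : forall x, #|[set l | I x l]| = q.+1.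
Hypothesis cardI2 : forall x y, x != y -> #|[set l | I x l && I l y]| = 1.
Hypothesis cardK : #|K| = q.
Hypothesis phi2 : forall l x y a b, I l x -> I l y -> x != y ->
  #|[set g | (phi l x g == a) && (phi l y g == b)]| = 1.
Hypothesis arc3 : forall l g,
  #|[set M in S | I l (c M) && (V l M == phi l (c M) g)]| <= 3.
Hypothesis dir1 : forall M M', M \in S -> M' \in S -> M != M' -> c M = c M' ->
  #|[set l | I (c M) l && (V l M == V l M')]| = 1.
(** Excludes an affine Fano configuration: if all three pairings of four points of a class are
    parallel, then [l1] does not separate its two pairs. *)
Hypothesis quad : odd q -> forall M1 M2 M3 M4 l1 l2 l3,
  uniq [:: M1; M2; M3; M4] -> {subset [:: M1; M2; M3; M4] <= S} ->
  c M2 = c M1 -> c M3 = c M1 -> c M4 = c M1 ->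
  I (c M1) l1 -> I (c M1) l2 -> I (c M1) l3 ->
  V l1 M1 = V l1 M2 -> V l1 M3 = V l1 M4 ->
  V l2 M1 = V l2 M3 -> V l2 M2 = V l2 M4 ->
  V l3 M1 = V l3 M4 -> V l3 M2 = V l3 M3 -> V l1 M1 = V l1 M3.

Definition cls x := [set M in S | c M == x].
Definition wt x := #|cls x|.
Definition seg l x a := [set M in cls x | V l M == a].
Definition swt l x a := #|seg l x a|.
Definition smax l x := \max_(a : K) swt l x a.
Definition lwt l := \sum_(x | I l x) wt x.

Lemma sum1I x (P : pred X) : \sum_(l | I x l) P l = #|[set l | I x l && P l]|.
Proof. by rewrite card_set_and. Qed.

(** A second point [y] of [l] splits the fibre into singletons, one for each of the [q] values at
    [y]. *)
Lemma card_fib l x a : I l x -> #|[set g | phi l x g == a]| = q.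
Proof.
move=> Ilx.
have [y /andP[Ily yx]] : exists y, I l y && (y != x).
  apply/existsP; apply: contraT; rewrite negb_exists => /forallP h.
  have : #|[set y | I l y]| <= #|[set x]|.
    apply: subset_leq_card; apply/subsetP => y; rewrite !inE => Ily.
    by move: (h y); rewrite Ily /= negbK.
  by rewrite cardI cards1; lia.
rewrite -sum1_card (eq_bigl (fun g => phi l x g == a)); last by move=> g; rewrite inE.
rewrite (partition_big (phi l y) xpredT) //=.
rewrite (eq_bigr (fun=> 1)); first by rewrite sum1_card.
move=> b _; rewrite eq_sym in yx; rewrite -[RHS](phi2 a b Ilx Ily yx) -sum1_card.
by apply: eq_bigl => g; rewrite inE.
Qed.

Lemma lwt_pts l : lwt l = \sum_(M in S | I l (c M)) 1.
Proof.
rewrite /lwt [RHS](partition_big c (I l)) /=; last by move=> M /andP[].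
apply: eq_bigr => x Ilx; rewrite /wt -sum1_card; apply: eq_bigl => M.
rewrite !inE -andbA; congr (_ && _).
by case: eqP => [->|]; rewrite ?Ilx ?andbF.
Qed.

Lemma wt_pts l x : I l x -> wt x = \sum_(M in S | I l (c M)) (c M == x).
Proof.
move=> Ilx; rewrite -card_set_and; apply: eq_card => M; rewrite !inE -andbA.
by case: eqP => [->|]; rewrite ?Ilx ?andbF.
Qed.

Lemma swt_pts l x a : I l x ->
  swt l x a = \sum_(M in S | I l (c M)) ((c M == x) && (V l M == a)).
Proof.
move=> Ilx; rewrite -(card_set_and _ (fun M => _ && _)).
apply: eq_card => M; rewrite !inE -!andbA.
by case: eqP => [->|]; rewrite ?Ilx ?andbF.
Qed.

Definition cov l g := #|[set M in S | I l (c M) && (V l M == phi l (c M) g)]|.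

Lemma cov_pts l g :
  cov l g = \sum_(M in S | I l (c M)) (V l M == phi l (c M) g).
Proof. by rewrite -card_set_and; apply: eq_card => M; rewrite !inE andbA. Qed.

(** The sum runs over the [q] lines containing segment [a] of class [x]. A point of that segment
    lies on all of them, another point of class [x] on none, and a point of another class over [l]
    on exactly one. *)
Lemma sum_cov l x a : I l x ->
  \sum_(g | phi l x g == a) cov l g + wt x = q * swt l x a + lwt l.
Proof.
move=> Ilx; rewrite (eq_bigr _ (fun g _ => cov_pts l g)) exchange_big /=.
rewrite (wt_pts Ilx) (swt_pts _ Ilx) lwt_pts big_distrr -!big_split /=.
apply: eq_bigr => M /andP[MS IlM].
have [e|ne] := eqVneq (c M) x.
  rewrite e /=; have [<-|na] := eqVneq (V l M) a.
    rewrite muln1 -[in RHS](card_fib (V l M) Ilx) -sum1_card; congr (_ + _).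
    rewrite [RHS](eq_bigl (fun g => phi l x g == V l M)); last by move=> g; rewrite inE.
    by apply: eq_bigr => g /eqP ->; rewrite eqxx.
  rewrite muln0 big1 // => g /eqP ->; by case: eqP na => // ->; rewrite eqxx.
rewrite /= muln0 addn0 add0n; rewrite eq_sym in ne.
rewrite -[RHS](phi2 a (V l M) Ilx IlM ne) card_set_and.
by apply: eq_bigr => g _; rewrite eq_sym.
Qed.

Lemma segB l x a : I l x -> q * swt l x a + lwt l <= 3 * q + wt x.
Proof.
move=> Ilx; rewrite -(sum_cov _ Ilx) leq_add2r.
apply: (@leq_trans (\sum_(g | phi l x g == a) 3)).
  by apply: leq_sum => g _; apply: arc3.
by rewrite sum_nat_const -(card_fib a Ilx) mulnC cardsE.
Qed.

Lemma smax_attained l x : exists a, smax l x = swt l x a.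
Proof.
have K0 : 0 < #|K| by rewrite cardK; lia.
by have [a _ e] := eq_bigmax_cond (swt l x) (A := predT) K0; exists a; rewrite -e.
Qed.

Lemma smaxB l x : I l x -> q * smax l x + lwt l <= 3 * q + wt x.
Proof. by move=> Ilx; have [a ->] := smax_attained l x; apply: segB. Qed.

Lemma leq_swt_smax l x a : swt l x a <= smax l x.
Proof. exact: (leq_bigmax_cond (F := swt l x)). Qed.

Lemma sum_swt l x : \sum_a swt l x a = wt x.
Proof.
rewrite /wt -sum1_card (partition_big (V l) xpredT) //=.
apply: eq_bigr => a _; rewrite /swt -sum1_card.
by apply: eq_bigl => M; rewrite !inE.
Qed.

Lemma leq_wt_lwt l x : I l x -> wt x <= lwt l.
Proof. by move=> Ilx; rewrite /lwt (bigD1 x) //= leq_addr. Qed.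

Lemma smax_le3 l x : I l x -> smax l x <= 3.
Proof. by move=> Ilx; have := smaxB Ilx; have := leq_wt_lwt Ilx; nia. Qed.

Lemma card_S : #|S| = \sum_x wt x.
Proof.
rewrite -sum1_card (partition_big c xpredT) //=; apply: eq_bigr => x _.
by rewrite /wt -sum1_card; apply: eq_bigl => M; rewrite inE.
Qed.

Lemma cardI2E x y : #|[set l | I x l && I l y]| = if x == y then q.+1 else 1.
Proof.
have [->|/cardI2//] := eqVneq x y.
by rewrite -(cardI y); apply: eq_card => l; rewrite !inE (Isym l) andbb.
Qed.

Lemma sum_lwt_pencil x : \sum_(l | I x l) lwt l = #|S| + q * wt x.
Proof.
transitivity (\sum_y \sum_(l | I x l) I l y * wt y).
  rewrite exchange_big /=; apply: eq_bigr => l _; rewrite /lwt big_mkcond /=.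
  by apply: eq_bigr => y _; case: (I l y); rewrite ?mul1n ?mul0n.
rewrite card_S (bigD1 x) //= [X in _ = X + _](bigD1 x) //= addnAC; congr (_ + _).
  by rewrite -big_distrl /= sum1I cardI2E eqxx mulSn.
apply: eq_bigr => y yx.
by rewrite -big_distrl /= sum1I cardI2E eq_sym (negbTE yx) mul1n.
Qed.

Lemma sum_pencil_const x n : \sum_(l | I x l) n = q.+1 * n.
Proof. by rewrite sum_nat_const -(cardI x) cardsE. Qed.

Lemma pencilB x :
  #|S| + q * \sum_(l | I x l) smax l x <= wt x + 3 * q * q.+1.
Proof.
have : \sum_(l | I x l) (q * smax l x + lwt l) <= \sum_(l | I x l) (3 * q + wt x).
  by apply: leq_sum => l Ixl; apply: smaxB; rewrite Isym.
rewrite big_split /= sum_lwt_pencil -big_distrr /= sum_pencil_const; nia.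
Qed.

(** [M] counts itself in each of the [q + 1] directions, and every other point of its class counts
    only in the direction joining it to [M]. *)
Lemma sum_swt_pt x M : M \in cls x ->
  \sum_(l | I x l) swt l x (V l M) = q + wt x.
Proof.
move=> Mx; have := Mx; rewrite inE => /andP[MS /eqP cM].
transitivity (\sum_(M' in cls x) \sum_(l | I x l) (V l M' == V l M)).
  rewrite exchange_big /=; apply: eq_bigr => l _.
  by rewrite /swt -card_set_and; apply: eq_card => M'; rewrite !inE.
rewrite (bigD1 M) //= (eq_bigr (fun=> 1)); last first.
  by move=> l _; rewrite eqxx.
rewrite sum_pencil_const muln1.
rewrite (eq_bigr (fun=> 1)).
  rewrite /wt [in RHS](cardsD1 M) Mx -[in RHS]sum1_card.
  rewrite [in RHS](eq_bigl (fun M' => (M' \in cls x) && (M' != M))); last first.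
    by move=> M'; rewrite !inE andbC.
  lia.
move=> M' /andP[]; rewrite inE => /andP[M'S /eqP cM'] ne.
rewrite sum1I -[RHS](dir1 M'S MS ne); last by rewrite cM cM'.
by rewrite cM'.
Qed.

Lemma sum_smax_ge x : 0 < wt x -> q + wt x <= \sum_(l | I x l) smax l x.
Proof.
case/card_gt0P=> M Mx; rewrite -(sum_swt_pt Mx).
by apply: leq_sum => l _; apply: leq_swt_smax.
Qed.

Lemma sum_smax_eq x : \sum_(l | I x l) smax l x <= q + wt x ->
  forall M l, M \in cls x -> I x l -> swt l x (V l M) = smax l x.
Proof.
move=> le M l Mx Ixl; apply/eqP; rewrite eqn_leq leq_swt_smax /= leqNgt.
apply/negP => lt; move: le; rewrite -(sum_swt_pt Mx) leqNgt => /negP; apply.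
rewrite (bigD1 l) //= [X in _ < X](bigD1 l) //= -addSn leq_add //.
by apply: leq_sum => l' _; apply: leq_swt_smax.
Qed.

(** Equality in [sum_smax_ge] holds term by term for every point of the class, so the nonempty
    segments in direction [l] all have size [smax l x] and partition the class. *)
Lemma smax_dvd x l : \sum_(l | I x l) smax l x <= q + wt x -> I x l -> smax l x %| wt x.
Proof.
move=> le Ixl; rewrite -(sum_swt l x); apply: dvdn_sum => a _.
have [->|] := posnP (swt l x a); first by rewrite dvdn0.
case/card_gt0P=> M; rewrite inE => /andP[Mx /eqP <-].
by rewrite (sum_smax_eq le).
Qed.

Lemma smax_gt0 x l : 0 < wt x -> 0 < smax l x.
Proof.
case/card_gt0P=> M Mx; apply: (leq_trans _ (leq_swt_smax l x (V l M))).
by apply/card_gt0P; exists M; rewrite inE Mx eqxx.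
Qed.

Lemma S_le_gen x : 0 < wt x -> #|S| <= 2 * q ^ 2 + 2 * q + 1.
Proof. by move=> w0; have := pencilB x; have := sum_smax_ge w0; nia. Qed.

Lemma smax_pigeon x l n : n * q < wt x -> n < smax l x.
Proof.
move=> h; rewrite ltnNge; apply/negP => le.
have : \sum_a swt l x a <= \sum_(a : K) n.
  by apply: leq_sum => a _; apply: leq_trans le; apply: leq_swt_smax.
by rewrite sum_swt sum_nat_const cardK; lia.
Qed.

(** Otherwise every [smax l x] divides [wt x], hence is at most 1, and the sum is at most [q + 1],
    less than [q + wt x]. *)
Lemma sum_smax_gt x : 1 < wt x -> (forall l, I x l -> smax l x %| wt x -> smax l x <= 1) ->
  q + wt x < \sum_(l | I x l) smax l x.
Proof.
move=> w1 h; rewrite ltnNge; apply/negP => le.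
have : \sum_(l | I x l) smax l x <= \sum_(l | I x l) 1.
  by apply: leq_sum => l Ixl; apply: h => //; apply: smax_dvd.
rewrite sum_pencil_const; have := sum_smax_ge (ltnW w1); lia.
Qed.

Lemma dir_ex M M' : M \in S -> M' \in S -> M != M' -> c M = c M' ->
  exists l, I (c M) l /\ V l M = V l M'.
Proof.
move=> MS M'S ne cc; have := dir1 MS M'S ne cc => /eqP/cards1P[l e].
have : l \in [set l] by rewrite inE.
by rewrite -e inE => /andP[? /eqP ?]; exists l.
Qed.

(** In the case of equality segment sizes divide 4 and are at most 3. So a segment with two points
    has no third, and the other two points form a parallel segment; the three pairings contradict
    [quad]. *)
Lemma sum_smax_odd4 x : odd q -> wt x = 4 -> q + 4 < \sum_(l | I x l) smax l x.
Proof.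
move=> oq w4; rewrite ltnNge -w4; apply/negP => le.
have [M1 [M2 [M3 [M4 [u e]]]]] : exists M1 M2 M3 M4,
    uniq [:: M1; M2; M3; M4] /\ cls x =i [:: M1; M2; M3; M4].
  have us := enum_uniq (cls x); have es := mem_enum (cls x).
  have : size (enum (cls x)) = 4 by rewrite -cardE.
  case: (enum _) us es => [|M1 [|M2 [|M3 [|M4 [|]]]]] // us es _.
  by exists M1, M2, M3, M4; split => // y; rewrite -es mem_enum.
have inS y : y \in [:: M1; M2; M3; M4] -> y \in S.
  by rewrite -e inE => /andP[].
have inC y : y \in [:: M1; M2; M3; M4] -> c y = x.
  by rewrite -e inE => /andP[_ /eqP].
have pairing A B C D : uniq [:: A; B; C; D] ->
    [:: A; B; C; D] =i [:: M1; M2; M3; M4] ->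
    exists l, [/\ I x l, V l A = V l B, V l C = V l D & V l A <> V l C].
  move=> u' e'; have cle : cls x =i [:: A; B; C; D] by move=> y; rewrite e e'.
  have AS : A \in S by apply: inS; rewrite -e' !inE eqxx.
  have BS : B \in S by apply: inS; rewrite -e' !inE eqxx orbT.
  have cA : c A = x by apply: inC; rewrite -e' !inE eqxx.
  have cB : c B = x by apply: inC; rewrite -e' !inE eqxx orbT.
  have AB : A != B by move: u'; rewrite /= !inE !negb_or -!andbA => /andP[].
  have [l [Il VAB]] := dir_ex AS BS AB (etrans cA (esym cB)).
  rewrite cA in Il; exists l.
  have Ax : A \in cls x by rewrite cle !inE eqxx.
  have Cx : C \in cls x by rewrite cle !inE eqxx !orbT.
  have mA := sum_smax_eq le Ax Il; have mC := sum_smax_eq le Cx Il.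
  have d := smax_dvd le Il; have m3 := smax_le3 (etrans (Isym _ _) Il).
  have segA a : seg l x a = [set M in [:: A; B; C; D] | V l M == a].
    by apply/setP => y; rewrite [LHS]inE [RHS]inE cle.
  have sizeE a : swt l x a = count (fun M => V l M == a) [:: A; B; C; D].
    rewrite /swt segA -size_filter -(card_uniqP _); last exact: filter_uniq.
    by apply: eq_card => y; rewrite [LHS]inE mem_filter andbC.
  rewrite !sizeE /= VAB !eqxx in mA mC.
  rewrite w4 in d.
  have m2 : smax l x = 2 by case: (smax l x) d m3 mA => [|[|[|[|]]]] //; lia.
  rewrite m2 in mA mC.
  have AC : V l B <> V l C.
    by move=> e1; move: mA; rewrite -e1 eqxx; clear; lia.
  rewrite VAB; split=> //.
  case: (eqVneq (V l C) (V l D)) => // /negbTE; rewrite eq_sym => ne.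
  rewrite ne in mC.
  case: eqP mA mC => [->|/eqP /negbTE]; rewrite ?eqxx; first by clear; lia.
  by rewrite eq_sym => ->; clear; lia.
have [l1 [I1 a1 b1 n1]] := pairing M1 M2 M3 M4 u (fun=> erefl).
have [l2 [I2 a2 b2 _]] : exists l,
    [/\ I x l, V l M1 = V l M3, V l M2 = V l M4 & V l M1 <> V l M2].
  apply: pairing; last by move=> y; rewrite !inE; do !case: eqP.
  move: u; rewrite /= !inE !negb_or; case/and4P => /and3P[-> -> ->] /andP[n ->] -> _.
  by rewrite eq_sym n.
have [l3 [I3 a3 b3 _]] : exists l,
    [/\ I x l, V l M1 = V l M4, V l M2 = V l M3 & V l M1 <> V l M2].
  apply: pairing; last by move=> y; rewrite !inE; do !case: eqP.
  move: u; rewrite /= !inE !negb_or; case/and4P.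
  by move=> /and3P[-> -> ->] /andP[-> n24] n34 _; rewrite !(eq_sym M4) n34 n24.
have c1 := inC M1 (mem_head _ _).
apply/n1/(quad oq u inS _ _ _ _ _ _ a1 b1 a2 b2 a3 b3); rewrite ?c1 //; apply: inC.
- by rewrite !inE eqxx ?orbT.
- by rewrite !inE eqxx ?orbT.
- by rewrite !inE eqxx ?orbT.
Qed.


(** What [pencilB] yields for a class of weight 4: the even value when the segment maxima sum to
    [q + 4], and [q] less when they sum to [q + 5]. *)
Definition bound := if odd q then 2 * q ^ 2 - 2 * q + 4 else 2 * q ^ 2 - q + 4.

Lemma S_le_wt4 x : 4 <= wt x -> #|S| <= bound.
Proof.
move=> w4; have B := pencilB x; have E := sum_smax_ge (leq_trans (isT : 0 < 4) w4).
have sumge n : n * q < wt x -> q.+1 * n.+1 <= \sum_(l | I x l) smax l x.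
  move=> h; rewrite -(sum_pencil_const x).
  by apply: leq_sum => l _; apply: smax_pigeon.
have [l0 Il0] : exists l, I x l.
  have : 0 < #|[set l | I x l]| by rewrite cardI.
  by case/card_gt0P=> l; rewrite inE; exists l.
have w3q : wt x <= 3 * q.
  rewrite leqNgt; apply/negP => /(@smax_pigeon x l0).
  by have := smax_le3 (etrans (Isym _ _) Il0); lia.
(* Beyond [2 * q] or [q] points the pigeonhole principle gives a maximum of at least 3 or 2 in every
   direction; from 6 to [q] points [sum_smax_ge] suffices. *)
have [lt2|le2] := ltnP (2 * q) (wt x).
  by have := sumge _ lt2; rewrite /bound; case: ifP => _; nia.
have [lt1|le1] := ltnP (1 * q) (wt x).
  by have := sumge _ lt1; rewrite /bound; case: ifP => _; nia.
have [lt5|le5] := ltnP 5 (wt x); first by rewrite /bound; case: ifP => _; nia.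
rewrite /bound; case: ifP => oq; last by nia.
(* For weight 5 the plain estimate is [2q^2 - 2q + 5], one too large for odd [q]; but neither 2 nor
   3 divides 5, so the strict form applies. *)
have [e5|] := eqVneq (wt x) 5.
  have : q + wt x < \sum_(l | I x l) smax l x.
    apply: sum_smax_gt; first by rewrite e5.
    move=> l Il; have := smax_le3 (etrans (Isym _ _) Il); rewrite e5.
    by case: (smax l x) => [|[|[|[|]]]].
  by nia.
move=> ne5; have e4 : wt x = 4 by lia.
by have := sum_smax_odd4 oq e4; nia.
Qed.

(** * Classes of weight at most 3: the second moment of the line weights *)

Section SmallClasses.

Hypothesis wt_le3 : forall x, wt x <= 3.

Lemma cov_seg l g : cov l g = \sum_(x | I l x) swt l x (phi l x g).
Proof.
rewrite cov_pts (partition_big c (I l)) /=; last by move=> M /andP[].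
apply: eq_bigr => x Ilx; rewrite -card_set_and; apply: eq_card => M.
rewrite !inE -!andbA; congr (_ && _).
by case: eqP => [->|]; rewrite ?Ilx ?andbF.
Qed.

Lemma one_bad l x y : I l x -> I l y -> x != y -> 1 < smax l x -> smax l y <= 1.
Proof.
move=> Ilx Ily xy; have [a ->] := smax_attained l x; have [b ->] := smax_attained l y.
move=> ha; rewrite leqNgt; apply/negP => hb.
have : 0 < #|[set g | (phi l x g == a) && (phi l y g == b)]| by rewrite phi2.
case/card_gt0P=> g; rewrite inE => /andP[/eqP ea /eqP eb].
have := arc3 l g; rewrite -/(cov l g) cov_seg (bigD1 x) //= (bigD1 y) /=; last first.
  by rewrite Ily eq_sym.
by rewrite ea eb; lia.
Qed.

(** The number squared is the least amount by which, according to [smaxB], a multiple segment of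
    class [x] makes [lwt l] fall short of [2 * q + 1]. *)
Definition cost l x :=
  if 1 < smax l x then (q * (smax l x - 1) + 1 - wt x) ^ 2 else 0.

(** The cost along [l] is at most the square of [2 * q + 1 - lwt l], expanded to avoid subtraction.
    By [one_bad] at most one summand is nonzero. *)
Lemma line_sq l :
  \sum_(x | I l x) cost l x + 2 * (2 * q + 1) * lwt l <= (2 * q + 1) ^ 2 + lwt l ^ 2.
Proof.
have [x /andP[Ilx bx]|nb] := pickP (fun x => I l x && (1 < smax l x)); last first.
  rewrite big1; first by rewrite add0n -mulnA; apply: (nat_Cauchy _ _).1.
  by move=> x Ilx; move: (nb x); rewrite Ilx /cost /= => ->.
rewrite (bigD1 x) //= big1; last first.
  move=> y /andP[Ily ny]; rewrite /cost ltnNge (one_bad Ilx Ily _ bx) //.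
  by rewrite eq_sym.
rewrite /cost bx addn0; have := smaxB Ilx; have := wt_le3 x.
move: (smax l x) (lwt l) (wt x) bx => m V' v m2 v3 B.
have : q * (m - 1) + 1 - v + V' <= 2 * q + 1 by nia.
move: (q * _ + 1 - v) (2 * q + 1) => z n h.
have -> : n = V' + (n - V') by lia.
have : z ^ 2 <= (n - V') ^ 2 by rewrite leq_exp2r //; lia.
by lia.
Qed.

Lemma sum_I_sym (F : X -> X -> nat) :
  \sum_l \sum_(x | I l x) F l x = \sum_x \sum_(l | I x l) F l x.
Proof.
rewrite (exchange_big_dep predT) //=; apply: eq_bigr => x _.
by apply: eq_bigl => l; rewrite Isym.
Qed.

Lemma sum_lwt : \sum_l lwt l = q.+1 * #|S|.
Proof.
rewrite sum_I_sym card_S big_distrr /=; apply: eq_bigr => x _.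
by rewrite sum_pencil_const.
Qed.

Lemma sum_lwt2 : \sum_l lwt l ^ 2 = q * (\sum_x wt x ^ 2) + #|S| ^ 2.
Proof.
transitivity (\sum_l \sum_(x | I l x) wt x * lwt l).
  by apply: eq_bigr => l _; rewrite -big_distrl /= -mulnn.
rewrite sum_I_sym -[in RHS]mulnn [X in _ + _ * X]card_S !big_distrr /= -big_split /=.
apply: eq_bigr => x _; rewrite -big_distrr /= sum_lwt_pencil; nia.
Qed.

Lemma sum_constX n : \sum_(x : X) n = (q ^ 2 + q + 1) * n.
Proof. by rewrite sum_nat_const -cardX. Qed.

Lemma sum_cost :
  \sum_x \sum_(l | I x l) cost l x + 2 * (2 * q + 1) * (q.+1 * #|S|) <=
  (q ^ 2 + q + 1) * (2 * q + 1) ^ 2 + (q * (\sum_x wt x ^ 2) + #|S| ^ 2).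
Proof.
rewrite -sum_I_sym -sum_lwt -sum_lwt2 -sum_constX big_distrr /= -!big_split /=.
by apply: leq_sum => l _; apply: line_sq.
Qed.

(** Since [wt x <= 3], this says that the class consists of three points of one segment. *)
Definition triple x := [exists l, I x l && (2 < smax l x)].

Lemma ntripleP x l : ~~ triple x -> I x l -> smax l x <= 2.
Proof.
rewrite negb_exists => /forallP/(_ l); rewrite negb_and => /orP[/negbTE->//|].
by rewrite -leqNgt.
Qed.

(** Here [smax l x] is 1 or 2, and each direction with value 2 costs [(q + 1 - wt x)^2]. *)
Lemma cost_ntriple x : ~~ triple x -> 0 < wt x ->
  \sum_(l | I x l) cost l x + q.+1 * (q + 1 - wt x) ^ 2 =
  (\sum_(l | I x l) smax l x) * (q + 1 - wt x) ^ 2.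
Proof.
move=> nt w0; rewrite -(sum_pencil_const x) -big_split big_distrl /=.
apply: eq_bigr => l Ixl; have := ntripleP nt Ixl; have := smax_gt0 l w0.
rewrite /cost; case: (smax l x) => [|[|[|]]] //= _ _; last by rewrite muln1; lia.
by rewrite mul1n.
Qed.

Lemma cost_ntriple_ge n x : ~~ triple x -> 0 < wt x ->
  q.+1 + n <= \sum_(l | I x l) smax l x ->
  n * (q + 1 - wt x) ^ 2 <= \sum_(l | I x l) cost l x.
Proof.
move=> nt w0 h; rewrite -(leq_add2r (q.+1 * (q + 1 - wt x) ^ 2)).
by rewrite cost_ntriple // -mulnDl leq_mul // addnC.
Qed.

Lemma cost_triple x : wt x = 3 -> triple x ->
  (2 * q - 2) ^ 2 <= \sum_(l | I x l) cost l x.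
Proof.
move=> w3 /existsP[l /andP[Ixl m3]]; rewrite (bigD1 l) //=.
apply: (leq_trans _ (leq_addr _ _)); rewrite /cost (ltnW m3) w3 leq_exp2r //; nia.
Qed.

(** A size at most 2 that divides 3 is 1. The excess over [q + 1] is thus at least 3: the sides of a
    triangle. *)
Lemma sum_smax_ntriple3 x : wt x = 3 -> ~~ triple x -> q + 3 < \sum_(l | I x l) smax l x.
Proof.
move=> w3 nt; rewrite -{1}w3; apply: sum_smax_gt; first by rewrite w3.
move=> l Il; have := ntripleP nt Il; rewrite w3.
by case: (smax l x) => [|[|[|]]].
Qed.

(* The quadratic polynomial in [wt x] is the one that interpolates the cost at
   [wt x = 1] and [wt x = 2]. *)
Lemma point_cost s x :
  (wt x = 3 -> ~~ triple x -> 2 * q ^ 2 - 2 * q + 2 <= 3 * (q - 2) ^ 2 + s) ->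
  q * wt x ^ 2 + (q ^ 2 + 1) * wt x + 4 * q <=
  \sum_(l | I x l) cost l x + (q ^ 2 + 1 + s) + 5 * q * wt x.
Proof.
move=> hs; have w3 := wt_le3 x.
have [w0|w0] := posnP (wt x); first by rewrite w0; nia.
have [w1|n1] := eqVneq (wt x) 1; first by rewrite w1; nia.
have [w2|n2] := eqVneq (wt x) 2.
  have nt : ~~ triple x.
    apply/negP => /existsP[l /andP[Ixl]]; have [a ->] := smax_attained l x.
    rewrite ltnNge -w2 => /negP; apply; apply: subset_leq_card.
    by apply/subsetP => M; rewrite inE => /andP[].
  have le := sum_smax_ge w0; rewrite w2 in le.
  have := cost_ntriple_ge (n := 1) nt w0; rewrite w2.
  have -> : q + 1 - 2 = q - 1 by lia.
  move: (\sum_(l | _) cost l x) => B; rewrite mul1n => /(_ ltac:(lia)).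
  have [r ->] : exists r, q = r + 1 by exists (q - 1); lia.
  by rewrite addnK; clear; lia.
have e3 : wt x = 3 by lia.
have [t|nt] := boolP (triple x).
  have := cost_triple e3 t; rewrite e3.
  move: (\sum_(l | _) cost l x) => B; clear -q5.
  have [r ->] : exists r, q = r + 5 by exists (q - 5); lia.
  have -> : 2 * (r + 5) - 2 = 2 * r + 8 by lia.
  by nia.
have le := sum_smax_ntriple3 e3 nt.
have := cost_ntriple_ge (n := 3) nt w0; rewrite e3.
have -> : q + 1 - 3 = q - 2 by lia.
move: (hs e3 nt) (\sum_(l | _) cost l x) => h B /(_ ltac:(lia)).
move: h; move: (3 * _) => C; clear -q5; nia.
Qed.

(** [s] is a slack granted to every point. At weight 3 the inequality of [point_cost] reads
    [2q^2 - 2q + 2 <= cost + s], and a triangle is only known to cost [3(q - 2)^2]. *)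
Lemma total_cost s :
  (forall x, wt x = 3 -> ~~ triple x -> 2 * q ^ 2 - 2 * q + 2 <= 3 * (q - 2) ^ 2 + s) ->
  (q ^ 2 + 1) * #|S| + (q ^ 2 + q + 1) * (4 * q) + 2 * (2 * q + 1) * (q.+1 * #|S|)
  <= (q ^ 2 + q + 1) * (2 * q + 1) ^ 2 + #|S| ^ 2 + (q ^ 2 + q + 1) * (q ^ 2 + 1 + s)
     + 5 * q * #|S|.
Proof.
move=> hs; have := sum_cost.
have : \sum_x (q * wt x ^ 2 + (q ^ 2 + 1) * wt x + 4 * q) <=
    \sum_x (\sum_(l | I x l) cost l x + (q ^ 2 + 1 + s) + 5 * q * wt x).
  by apply: leq_sum => x _; apply: point_cost; apply: hs.
rewrite !big_split /= !sum_constX -!big_distrr /= -card_S.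
move: (\sum_x \sum_(l | _) _) (\sum_x wt x ^ 2) => A B.
lia.
Qed.

(** * Lines of weight 12 without doubled segments, for q = 5 *)

(* The lines [g] are the points of an affine plane whose lines are the
   segments, so that [cov l] is the multiplicity of a point in an arrangement
   of 12 lines; [n2] counts its double points. *)
Section Order5.

Hypothesis q_eq5 : q = 5.
Variable l : X.
Hypothesis nobad : forall y, I l y -> smax l y <= 1.
Hypothesis W12 : lwt l = 12.

(** The deficiency of [g]: 0 at triple points, 1 at double points, 3 off the arrangement; [t_val]
    excludes 2. *)
Let t g := 3 - cov l g.
Let j2 y a := \sum_(g | phi l y g == a) (t g == 1).
Let n2 := \sum_g (t g == 1).

Let lwt_ge12 y : I l y -> 0 < wt y -> 12 <= 10 + wt y.
Proof.
move=> Ily w0; have := smaxB Ily; have := smax_gt0 l w0; have := nobad Ily.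
by rewrite W12 q_eq5; lia.
Qed.

(** So the deficiencies on a segment sum to [wt y - 2] if it is occupied and to [wt y + 3] if it is
    empty. *)
Let sum_t y a : I l y -> \sum_(g | phi l y g == a) t g + 5 * swt l y a = 3 + wt y.
Proof.
move=> Ily; have := sum_cov a Ily; rewrite W12.
have : \sum_(g | phi l y g == a) t g + \sum_(g | phi l y g == a) cov l g = 3 * 5.
  rewrite -big_split /= (eq_bigr (fun=> 3)) => [|g _]; last by rewrite subnK ?arc3.
  by rewrite sum_nat_const -q_eq5 -(card_fib a Ily) cardsE mulnC.
by rewrite q_eq5; lia.
Qed.

Let occupied M : M \in S -> I l (c M) -> swt l (c M) (V l M) = 1.
Proof.
move=> MS IM; apply/eqP; rewrite eqn_leq.
rewrite (leq_trans (leq_swt_smax _ _ _) (nobad IM)) /=.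
by apply/card_gt0P; exists M; rewrite !inE MS !eqxx.
Qed.

Let t_occ y g : I l y -> swt l y (phi l y g) = 1 -> t g <= 1.
Proof.
move=> Ily m1; have := sum_t (phi l y g) Ily; rewrite m1 (bigD1 g) //=.
by have := wt_le3 y; lia.
Qed.

(** A covered [g] lies on an occupied segment, whose total deficiency is at most 1. *)
Let t_val g : [|| t g == 0, t g == 1 | t g == 3].
Proof.
have [c0|] := posnP (cov l g); first by rewrite /t c0.
case/card_gt0P=> M; rewrite inE => /and3P[MS IM /eqP e].
have : t g <= 1 by apply: (t_occ IM); rewrite -e occupied.
by case: (t g) => [|[|]].
Qed.

Let j2_occ y a : I l y -> swt l y a = 1 -> j2 y a + 2 = wt y.
Proof.
move=> Ily m1; have := sum_t a Ily; rewrite m1.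
have -> : \sum_(g | phi l y g == a) t g = j2 y a.
  apply: eq_bigr => g /eqP e.
  have : t g <= 1 by apply: (t_occ Ily); rewrite e.
  by case: (t g) => [|[|]].
lia.
Qed.

Let j2_mod y a : I l y -> swt l y a = 0 -> j2 y a = wt y %[mod 3].
Proof.
move=> Ily m0; have := sum_t a Ily; rewrite m0.
have -> : \sum_(g | phi l y g == a) t g =
    j2 y a + 3 * \sum_(g | phi l y g == a) (t g == 3).
  rewrite big_distrr -big_split /=; apply: eq_bigr => g _.
  by case/or3P: (t_val g) => /eqP ->.
by lia.
Qed.

Let swt01 y a : I l y -> swt l y a = 0 \/ swt l y a = 1.
Proof.
move=> Ily; have := leq_trans (leq_swt_smax l y a) (nobad Ily).
by case: (swt _ _ _) => [|[|]] //; auto.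
Qed.

Let n2_pencil y : I l y -> n2 = \sum_a j2 y a.
Proof. by move=> _; rewrite /n2 (partition_big (phi l y) xpredT). Qed.

(** Incidences of double points with occupied segments: each double point lies on two of them, and
    the segment of [M] carries [wt (c M) - 2] double points. *)
Let double_n2 : 2 * n2 = \sum_(M in S | I l (c M)) (wt (c M) - 2).
Proof.
transitivity (\sum_(M in S | I l (c M)) j2 (c M) (V l M)); last first.
  apply: eq_bigr => M /andP[MS IM].
  by rewrite -(j2_occ IM (occupied MS IM)) addnK.
rewrite /n2 big_distrr /= /j2.
transitivity (\sum_g \sum_(M in S | I l (c M)) (V l M == phi l (c M) g) * (t g == 1)).
  apply: eq_bigr => g _; rewrite -big_distrl /= -cov_pts.
  have := arc3 l g; rewrite -/(cov l g) /t.
  by case: (cov l g) => [|[|[|[|]]]].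
rewrite exchange_big /=; apply: eq_bigr => M _; rewrite [RHS]big_mkcond /=.
by apply: eq_bigr => g _; rewrite eq_sym; case: eqP; rewrite ?mul1n ?mul0n.
Qed.

Let n2_le6 : n2 <= 6.
Proof.
have : 2 * n2 <= lwt l; last by rewrite W12; lia.
rewrite double_n2 lwt_pts; apply: leq_sum => M _; have := wt_le3 (c M); lia.
Qed.

(** Each of the three empty segments of a class of weight 2 would hold at least two double points,
    so [n2 >= 6]; its two occupied segments hold none, so [double_n2] gives [2 * n2 <= 10]. *)
Let no_w2 y : I l y -> wt y != 2.
Proof.
move=> Ily; apply/eqP => w2.
have : 6 <= n2.
  have : \sum_(a : K) 2 <= \sum_a (j2 y a + 2 * swt l y a).
    apply: leq_sum => a _; have [m0|->] := swt01 a Ily; last by lia.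
    by have := j2_mod Ily m0; rewrite w2; lia.
  rewrite big_split -big_distrr /= sum_swt -n2_pencil // sum_nat_const cardK.
  by rewrite q_eq5 w2; lia.
have : 2 * n2 + wt y <= lwt l; last by rewrite W12 w2; lia.
rewrite double_n2 (wt_pts Ily) lwt_pts -big_split; apply: leq_sum => M _ /=.
by have := wt_le3 (c M); case: eqP => [->|]; rewrite ?w2; lia.
Qed.

Let w03 y : I l y -> wt y = 0 \/ wt y = 3.
Proof.
move=> Ily; have [|w0] := posnP (wt y); first by left.
by right; have := no_w2 Ily; have := lwt_ge12 Ily w0; have := wt_le3 y; lia.
Qed.

(** All weights are 0 or 3. Of the six segments through a double point [g], two are occupied and
    hold one double point each; the other four hold at least 3 each: at least 14 in all. But [g] is
    counted six times and any other double point at most once, at most [5 + n2 <= 11] in all. *)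
Lemma lwt_neq12 : False.
Proof.
have [x /andP[Ilx w0]|none] := pickP (fun x => I l x && (0 < wt x)); last first.
  move: W12; rewrite /lwt big1 // => y Ily; move: (none y); rewrite Ily /=.
  by case: (wt y).
case/card_gt0P: (w0) => M; rewrite inE => /andP[MS /eqP cM].
have IM : I l (c M) by rewrite cM.
have wM : wt (c M) = 3 by case: (w03 IM) => //; rewrite cM => e; rewrite e in w0.
have : j2 (c M) (V l M) + 2 = 3 by rewrite (j2_occ IM) ?occupied.
have [g /andP[_ tg] _|none] :=
  pickP (fun g => (phi l (c M) g == V l M) && (t g == 1)); last first.
  rewrite /j2 big1 // => g e; move: (none g); rewrite e /= => ->//.
have up : \sum_(y | I l y) j2 y (phi l y g) <= 5 + n2.
  rewrite /j2; pose R y h := phi l y h == phi l y g.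
  have -> : \sum_(y | I l y) \sum_(h | R y h) (t h == 1) =
      \sum_h \sum_(y | I l y) R y h * (t h == 1).
    rewrite exchange_big /=; apply: eq_bigr => y _; rewrite big_mkcond /=.
    by apply: eq_bigr => h _; case: ifP; rewrite ?mul1n.
  rewrite /n2 (bigD1 g) //= [X in _ <= _ + X](bigD1 g) //= tg addnA leq_add //.
    rewrite (eq_bigr (fun=> 1)) => [|y _]; last by rewrite /R eqxx.
    by rewrite sum_pencil_const q_eq5.
  apply: leq_sum => h hg; rewrite -big_distrl /= -{2}(mul1n (_ == _ :> nat)).
  rewrite leq_mul // sum1I; apply/card_le1_eqP => y z; rewrite !inE.
  move=> /andP[Ily /eqP ey] /andP[Ilz /eqP ez]; apply/eqP; apply: contraT => yz.
  have := phi2 (phi l z g) (phi l y g) Ilz Ily yz => /eqP/cards1P[k e].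
  have hin : h \in [set k] by rewrite -e inE ey ez !eqxx.
  have gin : g \in [set k] by rewrite -e inE !eqxx.
  by move: hin gin hg; rewrite !inE => /eqP -> /eqP ->; rewrite eqxx.
have c2 : cov l g = 2.
  move: tg; rewrite /t; have := arc3 l g; rewrite -/(cov l g).
  by case: (cov l g) => [|[|[|[|]]]].
have : \sum_(y | I l y) 3 <= \sum_(y | I l y) (j2 y (phi l y g) + 2 * swt l y (phi l y g)).
  apply: leq_sum => y Ily; have [m0|m1] := swt01 (phi l y g) Ily.
    rewrite m0 muln0 addn0; have := j2_mod Ily m0.
    have : 0 < j2 y (phi l y g) by rewrite /j2 (bigD1 g) //= tg.
    by case: (w03 Ily) => ->; lia.
  have := j2_occ Ily m1; rewrite m1; case: (w03 Ily) => ->; lia.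
rewrite big_split -big_distrr /= -cov_seg c2 sum_pencil_const q_eq5.
by have := n2_le6; lia.
Qed.

End Order5.

(** A doubled segment on [l] leaves at most 8. Otherwise [lwt l <= 10 + wt y] for each occupied [y],
    so at most 13; the value 12 is excluded above, and 13 would make all occupied weights equal to
    3, which does not divide 13. *)
Lemma lwt_le11 l x : q = 5 -> I l x -> wt x = 3 -> lwt l <= 11.
Proof.
move=> e5 Ilx w3.
have [y /andP[Ily by_]|nb] := pickP (fun y => I l y && (1 < smax l y)).
  by have := smaxB Ily; have := wt_le3 y; rewrite e5; nia.
have nobad y : I l y -> smax l y <= 1.
  by move=> Ily; rewrite leqNgt; move: (nb y); rewrite Ily /= => ->.
have lwt_ge12 y : I l y -> 0 < wt y -> lwt l <= 10 + wt y.
  move=> Ily w0; have := smaxB Ily; have := smax_gt0 l w0; have := nobad y Ily.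
  by rewrite e5; lia.
rewrite leqNgt; apply/negP => W12.
have Wx : lwt l <= 13 by have := lwt_ge12 x Ilx; rewrite w3 => /(_ isT).
have [e|ne] := eqVneq (lwt l) 12; first exact: (lwt_neq12 e5 nobad e).
have e13 : lwt l = 13 by lia.
have : 3 %| lwt l.
  apply: dvdn_sum => y Ily; have [->//|w0] := posnP (wt y).
  by have := lwt_ge12 y Ily w0; have := wt_le3 y; rewrite e13; case: (wt y) => [|[|[|[|]]]].
by rewrite e13.
Qed.

(** One less than [bound] for even [q], so triangles remain a concern for odd [q] only. *)
Lemma S_le_ntriple x : wt x = 3 -> ~~ triple x -> #|S| <= 2 * q ^ 2 - q + 3.
Proof.
by move=> w3 nt; have := sum_smax_ntriple3 w3 nt; have := pencilB x; rewrite w3; nia.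
Qed.

Lemma S_le_ntriple5 x : q = 5 -> wt x = 3 -> ~~ triple x -> #|S| <= 44.
Proof.
move=> e5 w3 nt; have := sum_lwt_pencil x; have := sum_smax_ntriple3 w3 nt.
rewrite w3 e5.
(* Both cases give 14: [11 + 3 * 1] without a doubled segment in class [x], and [8 + 3 * 2] with
   one, where [smaxB] limits the line weight to 8. *)
have : \sum_(l | I x l) (lwt l + 3 * smax l x) <= \sum_(l | I x l) 14.
  apply: leq_sum => l Ixl; have Ilx : I l x by rewrite Isym.
  have := ntripleP nt Ixl; have := smaxB Ilx; have := lwt_le11 e5 Ilx w3.
  have : 0 < smax l x by apply: smax_gt0; rewrite w3.
  by rewrite w3 e5; case: (smax l x) => [|[|[|]]] //; lia.
rewrite big_split -big_distrr /= sum_pencil_const e5.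
by move: (\sum_(l | _) lwt l) (\sum_(l | _) smax l x) => A B; lia.
Qed.

Lemma S_le_wt3 : #|S| <= bound.
Proof.
rewrite leqNgt; apply/negP => gt.
have B : 2 * q ^ 2 - 2 * q + 5 <= #|S| by move: gt; rewrite /bound; case: ifP => _; nia.
have U : #|S| <= 2 * q ^ 2 + 2 * q + 1.
  have [x w0|none] := pickP (fun x => 0 < wt x); first exact: S_le_gen w0.
  by rewrite card_S big1 // => x _; move: (none x); case: (wt x).
have O x : wt x = 3 -> ~~ triple x -> odd q && (7 <= q).
  move=> w3 nt; move: gt; have := S_le_ntriple w3 nt; rewrite /bound.
  case: ifP => oq; last by lia.
  have [e5|n5] := eqVneq q 5; first by have := S_le_ntriple5 e5 w3 nt; rewrite e5; lia.
  by move=> _ _ /=; have [e6|] := eqVneq q 6; [rewrite e6 in oq | lia].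
(* For [q = 7] the cost of a triangle falls short by [86 - 75 = 11]. In the other cases slack 0
   works: for odd [q >= 9] the cost suffices, and otherwise [O] rules out triangles. *)
have [e7|n7] := eqVneq q 7.
  have := @total_cost 11; rewrite e7 => /(_ (fun _ _ _ => isT)).
  by move: B U; rewrite e7; nia.
have := @total_cost 0.
have H x : wt x = 3 -> ~~ triple x -> 2 * q ^ 2 - 2 * q + 2 <= 3 * (q - 2) ^ 2 + 0.
  move=> w3 nt; have := O x w3 nt => /andP[oq q7].
  have q9 : 9 <= q.
    by have [e8|] := eqVneq q 8; [rewrite e8 in oq | lia].
  have [p ->] : exists p, q = p + 9 by exists (q - 9); lia.
  have -> : p + 9 - 2 = p + 7 by lia.
  by nia.
move=> /(_ H).
(* In terms of [d], [total_cost] becomes [key]. With [d <= 4q - 3] it would imply [q(q - 2)(q^2 + q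
   + 1) <= (4q - 3)(q^2 + q - 4)], which fails for [q >= 5]. *)
have [d ed] : exists d, #|S| + d = 2 * (q ^ 2 + q + 1).
  by exists (2 * (q ^ 2 + q + 1) - #|S|); lia.
have d_le : d + 3 <= 4 * q by nia.
move: #|S| ed {gt B U O H n7} => k ed E.
have e1 := congr1 (muln k) ed; have e2 := congr1 (muln d) ed.
have e3 := congr1 (muln q) ed; have e4 := congr1 (muln (q ^ 2)) ed.
have key : q ^ 2 * (q ^ 2 + q + 1) + (3 * q + 1) * d <=
    d ^ 2 + q ^ 2 * d + 2 * q * (q ^ 2 + q + 1) by lia.
have dd : d ^ 2 + 3 * d <= 4 * q * d by rewrite -mulnn -mulnDl leq_mul2r d_le orbT.
have qd : (q ^ 2 + q - 4) * (d + 3) <= (q ^ 2 + q - 4) * (4 * q).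
  by rewrite leq_mul2l d_le orbT.
move: key dd qd; clear -q5.
have [r ->] : exists r, q = r + 5 by exists (q - 5); lia.
have -> : (r + 5) ^ 2 + (r + 5) - 4 = r ^ 2 + 11 * r + 26 by lia.
by lia.
Qed.

End SmallClasses.

Theorem card_arc_le : #|S| <= bound.
Proof.
have [x w4|w3] := pickP (fun x => 4 <= wt x); first exact: S_le_wt4 w4.
by apply: S_le_wt3 => x; rewrite leqNgt w3.
Qed.

End ArcCombinatorics.

(** * Ideals, units and a generator of the radical *)

Section ChainRing.

Local Open Scope ring_scope.

Variable R : finNzRingType.

Lemma is_ridealP (I : {set R}) :
  reflect [/\ 0 \in I, (forall x y, x \in I -> y \in I -> x - y \in I)
            & (forall x r, x \in I -> x * r \in I)] (is_rideal I).
Proof.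
apply: (iffP andP) => [[/andP[I0 /forallP h1] /forallP h2]|[I0 h1 h2]]; split=> //.
- by move=> x y xI yI; move/forallP/(_ y): (h1 x); rewrite xI yI.
- by move=> x r xI; move/forallP/(_ r): (h2 x); rewrite xI.
- rewrite I0; apply/forallP => x; apply/forallP => y.
  by apply/implyP => xI; apply/implyP; apply: h1.
- by apply/forallP => x; apply/forallP => r; apply/implyP; apply: h2.
Qed.

Lemma is_lidealP (I : {set R}) :
  reflect [/\ 0 \in I, (forall x y, x \in I -> y \in I -> x - y \in I)
            & (forall x r, x \in I -> r * x \in I)] (is_lideal I).
Proof.
apply: (iffP andP) => [[/andP[I0 /forallP h1] /forallP h2]|[I0 h1 h2]]; split=> //.
- by move=> x y xI yI; move/forallP/(_ y): (h1 x); rewrite xI yI.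
- by move=> x r xI; move/forallP/(_ r): (h2 x); rewrite xI.
- rewrite I0; apply/forallP => x; apply/forallP => y.
  by apply/implyP => xI; apply/implyP; apply: h1.
- by apply/forallP => x; apply/forallP => r; apply/implyP; apply: h2.
Qed.

Lemma principal_rideal (x : R) : is_rideal [set x * r | r in R].
Proof.
apply/is_ridealP; split; first by apply/imsetP; exists 0; rewrite ?mulr0.
  move=> _ _ /imsetP[a _ ->] /imsetP[b _ ->]; apply/imsetP.
  by exists (a - b) => //; rewrite mulrBr.
move=> _ r /imsetP[a _ ->]; apply/imsetP.
by exists (a * r) => //; rewrite mulrA.
Qed.

Lemma principal_lideal (x : R) : is_lideal [set r * x | r in R].
Proof.
apply/is_lidealP; split; first by apply/imsetP; exists 0; rewrite ?mul0r.
  move=> _ _ /imsetP[a _ ->] /imsetP[b _ ->]; apply/imsetP.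
  by exists (a - b) => //; rewrite mulrBl.
move=> _ r /imsetP[a _ ->]; apply/imsetP.
by exists (r * a) => //; rewrite mulrA.
Qed.

Hypothesis chainR : chain_ring_len2 R.
Hypothesis properJ : jrad R != setT.
Local Notation J := (jrad R).

Lemma rideal3 (I : {set R}) : is_rideal I -> [\/ I = setT, I = J | I = [set 0]].
Proof.
case: chainR => _ [-> _]; rewrite !inE -orbA => /or3P[] /eqP ->;
  by [constructor 1 | constructor 2 | constructor 3].
Qed.

Lemma lideal3 (I : {set R}) : is_lideal I -> [\/ I = setT, I = J | I = [set 0]].
Proof.
case: chainR => _ [_ ->]; rewrite !inE -orbA => /or3P[] /eqP ->;
  by [constructor 1 | constructor 2 | constructor 3].
Qed.

Lemma jrad_rideal : is_rideal J.
Proof. by case: chainR => _ [-> _]; rewrite !inE eqxx orbT. Qed.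

Lemma jrad_lideal : is_lideal J.
Proof. by case: chainR => _ [_ ->]; rewrite !inE eqxx orbT. Qed.

Lemma jrad0 : 0 \in J. Proof. by case/is_ridealP: jrad_rideal. Qed.
Lemma jradB x y : x \in J -> y \in J -> x - y \in J.
Proof. by case/is_ridealP: jrad_rideal => _ h _; apply: h. Qed.
Lemma jradMr x y : x \in J -> x * y \in J.
Proof. by case/is_ridealP: jrad_rideal => _ _ h; apply: h. Qed.
Lemma jradMl x y : y \in J -> x * y \in J.
Proof. by case/is_lidealP: jrad_lideal => _ _ h; apply: h. Qed.

Lemma jrad1 : 1 \notin J.
Proof.
apply: contra properJ => h1; apply/eqP/setP => x; rewrite inE.
by rewrite -[x]mul1r jradMr.
Qed.

(** The right and the left ideal generated by [x] are not inside [J], so both are the whole ring. *)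
Lemma jrad_unit x : x \notin J -> exists y, y * x = 1 /\ x * y = 1.
Proof.
move=> xJ.
have x0 : x != 0 by apply: contraNneq xJ => ->; apply: jrad0.
have rI := principal_rideal x; have lI := principal_lideal x.
have xr : x \in [set x * r | r in R] by apply/imsetP; exists 1; rewrite ?mulr1.
have xl : x \in [set r * x | r in R] by apply/imsetP; exists 1; rewrite ?mul1r.
have er : [set x * r | r in R] = setT.
  case: (rideal3 rI) => // e; move: xr; rewrite e; first by rewrite (negbTE xJ).
  by rewrite inE (negbTE x0).
have el : [set r * x | r in R] = setT.
  case: (lideal3 lI) => // e; move: xl; rewrite e; first by rewrite (negbTE xJ).
  by rewrite inE (negbTE x0).
have /imsetP[y _ xy] : 1 \in [set x * r | r in R] by rewrite er inE.
have /imsetP[z _ zx] : 1 \in [set r * x | r in R] by rewrite el inE.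
by exists z; split=> //; rewrite xy; congr (_ * _); rewrite -[y]mul1r zx -mulrA -xy mulr1.
Qed.

(** The right annihilator of [x] is a right ideal. Were it zero, multiplication by [x] would be
    injective, hence onto the finite ring, and 1 would lie in [J]; so it contains [J]. *)
Lemma jrad_mul0 x y : x \in J -> y \in J -> x * y = 0.
Proof.
move=> xJ yJ; pose A := [set r | x * r == 0].
have rA : is_rideal A.
  apply/is_ridealP; split; first by rewrite inE mulr0.
    by move=> a b; rewrite !inE mulrBr => /eqP -> /eqP ->; rewrite subrr.
  by move=> a r; rewrite !inE mulrA => /eqP ->; rewrite mul0r.
have : y \in A.
  case: (rideal3 rA) => [->|->|e0]; rewrite ?inE //.
  have inj : injective ( *%R x).
    move=> a b e; apply/eqP; rewrite -subr_eq0.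
    suff : a - b \in A by rewrite e0 inE.
    by rewrite inE mulrBr e subrr.
  case/negP: jrad1; have [f' _ fK] := injF_bij inj.
  by rewrite -(fK 1) jradMr.
by rewrite inE => /eqP.
Qed.

(** Any nonzero [t] of the radical works: on either side it generates a nonzero ideal inside [J],
    and no unit annihilates it. *)
Lemma jrad_generator : exists t, [/\ t != 0 /\ t \in J,
  (forall x, x \in J -> exists r, x = t * r),
  (forall x, x \in J -> exists r, x = r * t),
  (forall r, (t * r == 0) = (r \in J)) & (forall r, (r * t == 0) = (r \in J))].
Proof.
have [t tJ t0] : exists2 t, t \in J & t != 0.
  case: chainR => nz _; apply/exists_inP; apply: contraR nz.
  rewrite negb_exists_in => /forall_inP h; apply/eqP/setP => x; rewrite inE.
  apply/idP/eqP => [/h|->]; last exact: jrad0.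
  by rewrite negbK => /eqP.
have rI := principal_rideal t; have lI := principal_lideal t.
exists t; split=> //.
- move=> x xJ; suff /imsetP[r _ ->] : x \in [set t * r | r in R] by exists r.
  case: (rideal3 rI) => e; rewrite e ?inE //.
  have : t \in [set t * r | r in R] by apply/imsetP; exists 1; rewrite ?mulr1.
  by rewrite e inE (negbTE t0).
- move=> x xJ; suff /imsetP[r _ ->] : x \in [set r * t | r in R] by exists r.
  case: (lideal3 lI) => e; rewrite e ?inE //.
  have : t \in [set r * t | r in R] by apply/imsetP; exists 1; rewrite ?mul1r.
  by rewrite e inE (negbTE t0).
- move=> r; apply/idP/idP => [/eqP e|rJ]; last by rewrite jrad_mul0.
  apply: contraT => /jrad_unit[y [_ ry]].
  by case/eqP: t0; rewrite -[t]mulr1 -ry mulrA e mul0r.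
- move=> r; apply/idP/idP => [/eqP e|rJ]; last by rewrite jrad_mul0.
  apply: contraT => /jrad_unit[y [yr _]].
  by case/eqP: t0; rewrite -[t]mul1r -yr -mulrA e mulr0.
Qed.

End ChainRing.

(** * Coordinates for points, segments and lines of the Hjelmslev plane *)

Section Coordinates.

Local Open Scope ring_scope.

Variables (R : finNzRingType) (F : finFieldType) (pi : R -> F) (t : R).
Hypothesis piD : {morph pi : x y / x + y}.
Hypothesis piM : {morph pi : x y / x * y}.
Hypothesis pi_onto : forall a, exists x, pi x = a.
Hypothesis pi_unit : forall x, pi x != 0 -> exists y, y * x = 1 /\ x * y = 1.
Hypothesis t0 : t != 0.
Hypothesis pit : pi t = 0.
Hypothesis t_left : forall x, pi x = 0 -> exists r, x = t * r.
Hypothesis t_right : forall x, pi x = 0 -> exists r, x = r * t.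
Hypothesis tl0 : forall r, (t * r == 0) = (pi r == 0).
Hypothesis tr0 : forall r, (r * t == 0) = (pi r == 0).

Let pi0 : pi 0 = 0.
Proof. by apply: (addrI (pi 0)); rewrite -piD !addr0. Qed.

Let piN x : pi (- x) = - pi x.
Proof. by apply: (addrI (pi x)); rewrite -piD !subrr pi0. Qed.

Let piB x y : pi (x - y) = pi x - pi y.
Proof. by rewrite piD piN. Qed.

Let pi_sum (I : finType) (f : I -> R) : pi (\sum_i f i) = \sum_i pi (f i).
Proof. exact: (big_morph _ piD pi0). Qed.

(** A section of [pi] without algebraic compatibility; sums and products of lifts are compared only
    after multiplication by [t], which kills the discrepancy. *)
Definition lft (a : F) : R := odflt 0 [pick x | pi x == a].

Let pi_lft a : pi (lft a) = a.
Proof.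
rewrite /lft; case: pickP => [x /eqP//|h]; have [x e] := pi_onto a.
by move: (h x); rewrite e eqxx.
Qed.

Definition lftv (v : 'rV[F]_3) : 'rV[R]_3 := map_mx lft v.

Definition rdot (a x : 'rV[R]_3) : R := \sum_i a 0 i * x 0 i.

Definition piv (x : 'rV[R]_3) : 'rV[F]_3 := map_mx pi x.

Let pi_lftv v : piv (lftv v) = v.
Proof. by apply/rowP => i; rewrite !mxE pi_lft. Qed.

Let pi_rdot a x : pi (rdot a x) = dot (piv a) (piv x).
Proof.
by rewrite /rdot pi_sum dotE; apply: eq_bigr => i _; rewrite piM !mxE.
Qed.

Let pi_rdot_eq u v v' :
  (pi (rdot (lftv u) (lftv v)) == pi (rdot (lftv u) (lftv v'))) =
  (dot u (v - v') == 0).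
Proof.
have E z : pi (rdot (lftv u) (lftv z)) = dot u z by rewrite pi_rdot !pi_lftv.
by rewrite (E v) (E v') dotBr subr_eq0.
Qed.

Let rdot_rmul a x r : rdot a (rmul x r) = rdot a x * r.
Proof. by rewrite /rdot big_distrl /=; apply: eq_bigr => i _; rewrite !mxE mulrA. Qed.

Let eq_tl x y : (t * x == t * y) = (pi x == pi y).
Proof. by rewrite -subr_eq0 -mulrBr tl0 piB subr_eq0. Qed.

Let eq_tr x y : (x * t == y * t) = (pi x == pi y).
Proof. by rewrite -subr_eq0 -mulrBl tr0 piB subr_eq0. Qed.

Definition hyperplane (a : 'rV[R]_3) : {set 'rV[R]_3} := [set v | rdot a v == 0].

(** Some coefficient is a unit; its coordinate is solved for and the other two are free, which gives
    the basis [B]. *)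
Lemma hyperplane_line a : piv a != 0 -> is_line (hyperplane a).
Proof.
move=> a0.
have [i ai] : exists i, pi (a 0 i) != 0.
  by exists (pivot (piv a)); have := pivotP a0; rewrite mxE.
have [b [ba ab]] := pi_unit ai.
apply/existsP.
pose B : {ffun 'I_2 -> 'rV[R]_3} := [ffun k : 'I_2 => \row_j
  (if unlift i j is Some k' then (k' == k)%:R else - (b * a 0 (lift i k)))].
have combl (d : {ffun 'I_2 -> R}) (k : 'I_2) : comb B d 0 (lift i k) = d k.
  rewrite /comb summxE (bigD1 k) //= big1 ?addr0; last first.
    move=> k' nk; rewrite !mxE ffunE mxE liftK eq_sym (negbTE nk) mul0r //.
  by rewrite !mxE ffunE mxE liftK eqxx mul1r.
have combi (d : {ffun 'I_2 -> R}) :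
    comb B d 0 i = - (b * \sum_(k < 2) a 0 (lift i k) * d k).
  rewrite /comb summxE big_distrr /= -sumrN; apply: eq_bigr => k _.
  by rewrite !mxE ffunE mxE unlift_none mulNr mulrA.
exists B; apply/andP; split.
  apply/injectiveP => d d' e; apply/ffunP => k.
  by rewrite -combl e combl.
apply/eqP/setP => v; rewrite inE; apply/idP/imsetP => [/eqP e|[d _ ->]].
  exists [ffun k => v 0 (lift i k)] => //; apply/rowP => j.
  case: (unliftP i j) => [k ->|->]; first by rewrite combl ffunE.
  rewrite combi; move: e; rewrite /rdot (bigD1_ord i) //= => e.
  rewrite (eq_bigr (fun k => a 0 (lift i k) * v 0 (lift i k))); last first.
    by move=> k _; rewrite ffunE.
  rewrite -[v 0 i]mul1r -ba -mulrA -mulrN; congr (_ * _).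
  by apply/eqP; rewrite -addr_eq0 e.
rewrite /rdot (bigD1_ord i) //= combi mulrN mulrA ab mul1r.
rewrite [X in _ + X](eq_bigr (fun k => a 0 (lift i k) * d k)); first by rewrite addNr.
by move=> k _; rewrite combl.
Qed.

Definition norm_rep (M : {set 'rV[R]_3}) (x : 'rV[R]_3) :=
  [&& piv x != 0, nrm (piv x) == piv x & M == [set rmul x r | r in R]].

(** A generator vanishing modulo the radical would be killed by [t], against freeness. Scaling by a
    lift of the inverse of its pivot entry normalises it. *)
Lemma point_norm_rep M : is_point M -> exists x, norm_rep M x.
Proof.
case/existsP => b /andP[/injectiveP inj /eqP e].
pose x := b ord0.
have combE (d : {ffun 'I_1 -> R}) : comb b d = rmul x (d ord0).
  by rewrite /comb big_ord1.
have Mx : M = [set rmul x r | r in R].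
  rewrite e; apply/setP => v; apply/imsetP/imsetP => [[d _ ->]|[r _ ->]].
    by exists (d ord0) => //; rewrite combE.
  by exists [ffun => r] => //; rewrite combE ffunE.
have x0 : piv x != 0.
  apply/eqP => x0; have := inj [ffun => t] [ffun => 0].
  rewrite !combE !ffunE => h; case/eqP: t0.
  have /h/ffunP/(_ ord0) : rmul x t = rmul x 0; last by rewrite !ffunE.
  apply/rowP => i; rewrite !mxE mulr0; apply/eqP; rewrite tr0.
  by move/rowP/(_ i): x0; rewrite !mxE => ->.
pose a := ((piv x) 0 (pivot (piv x)))^-1.
have a0 : a != 0 by rewrite invr_eq0 pivotP.
have /pi_unit[y [yr ry]] : pi (lft a) != 0 by rewrite pi_lft.
exists (rmul x (lft a)).
have pix : piv (rmul x (lft a)) = nrm (piv x).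
  apply/rowP => i; rewrite !mxE piM pi_lft mulrC -/a.
  by congr (_ * _); rewrite /a mxE.
rewrite /norm_rep pix nrm_neq0 // nrmK // eqxx /= Mx; apply/eqP/setP => v.
have rA z r s : rmul (rmul z r) s = rmul z (r * s).
  by apply/rowP => i; rewrite !mxE mulrA.
apply/imsetP/imsetP => [[r _ ->]|[r _ ->]].
  by exists (y * r) => //; rewrite rA mulrA ry mul1r.
by exists (lft a * r) => //; rewrite rA.
Qed.

Variables (p0 : ppoint F) (S : {set {set 'rV[R]_3}}).
Hypothesis S_point : forall M, M \in S -> is_point M.
Hypothesis S_arc : forall L, is_line L -> (#|[set M in S | M \subset L]| <= 3)%N.

Definition pt M := odflt 0 [pick x | norm_rep M x].
Definition pclass M : ppoint F := insubd p0 (piv (pt M)).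
(** Coordinates of a radical element with respect to [t]; left and right versions are kept apart
    because [R] may be noncommutative. *)
Definition ldiv x : F := odflt 0 [pick a | x == t * lft a].
Definition rdiv x : F := odflt 0 [pick a | x == lft a * t].
Definition segval (l : ppoint F) M : F := ldiv (rdot (lftv (val l)) (pt M)).
(** The affine position of [M] in its class. Another normalised representative shifts it by a
    multiple of the class vector. *)
Definition acoord M : 'rV[F]_3 :=
  \row_i rdiv (pt M 0 i - lft (val (pclass M) 0 i)).

Let ldivP x : pi x = 0 -> x = t * lft (ldiv x).
Proof.
move=> x0; rewrite /ldiv; case: pickP => [a /eqP//|h].
have [r e] := t_left x0; move: (h (pi r)).
by rewrite e eq_tl pi_lft eqxx.
Qed.

Let rdivP x : pi x = 0 -> x = lft (rdiv x) * t.
Proof.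
move=> x0; rewrite /rdiv; case: pickP => [a /eqP//|h].
have [r e] := t_right x0; move: (h (pi r)).
by rewrite e eq_tr pi_lft eqxx.
Qed.

Let pt_rep M : M \in S -> norm_rep M (pt M).
Proof.
move=> /S_point/point_norm_rep[x hx]; rewrite /pt; case: pickP => // /(_ x).
by rewrite hx.
Qed.

Let ptE M : M \in S -> M = [set rmul (pt M) r | r in R].
Proof. by move/pt_rep/and3P => [_ _ /eqP]. Qed.

Let pi_pt M : M \in S -> piv (pt M) = val (pclass M).
Proof.
by move/pt_rep/and3P => [h1 h2 _]; rewrite /pclass insubdK // -topredE /= h1 h2.
Qed.

Let segvalP l M : M \in S -> inc l (pclass M) ->
  rdot (lftv (val l)) (pt M) = t * lft (segval l M).
Proof. by move=> MS /eqP h; apply: ldivP; rewrite pi_rdot pi_lftv pi_pt. Qed.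

Let acoordP M i : M \in S ->
  pt M 0 i = lft (val (pclass M) 0 i) + lft (acoord M 0 i) * t.
Proof.
move=> MS; have -> : acoord M 0 i = rdiv (pt M 0 i - lft (val (pclass M) 0 i)).
  by rewrite /acoord mxE.
have d0 : pi (pt M 0 i - lft (val (pclass M) 0 i)) = 0.
  by rewrite piB pi_lft -(pi_pt MS) mxE subrr.
by rewrite -(rdivP d0) [RHS]addrC subrK.
Qed.

Local Opaque lft pt pclass segval acoord.

(** [a] is a coefficient vector of the line [g]: at [pt M] it takes the value [t] times an element
    of residue [segval l M - seg_form l (pclass M) g], so all counted points lie on one line. *)
Lemma arc_seg l g :
  (#|[set M in S | inc l (pclass M) && (segval l M == seg_form l (pclass M) g)]| <= 3)%N.
Proof.
pose a : 'rV[R]_3 := \row_i (lft (val l 0 i) + t * lft (emb l g 0 i)).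
have pia : piv a = val l.
  by apply/rowP => i; rewrite !mxE piD piM pit mul0r addr0 pi_lft.
have := S_arc (@hyperplane_line a _); rewrite pia ppoint_neq0 => /(_ isT).
apply: leq_trans; apply: subset_leq_card; apply/subsetP => M.
rewrite !inE => /and3P[MS IM /eqP sM]; rewrite MS /=; apply/subsetP => v.
rewrite {1}(ptE MS) => /imsetP[r _ ->]; rewrite inE rdot_rmul.
suff -> : rdot a (pt M) = 0 by rewrite mul0r.
have -> : rdot a (pt M) =
    rdot (lftv (val l)) (pt M) + t * rdot (lftv (emb l g)) (pt M).
  rewrite /rdot big_distrr -big_split; apply: eq_bigr => i _ /=.
  by rewrite !mxE mulrDl mulrA.
rewrite segvalP // -mulrDr; apply/eqP; rewrite tl0 piD pi_lft pi_rdot pi_lftv pi_pt //.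
by rewrite sM /seg_form addNr.
Qed.

Let rdot_acoord l M : M \in S -> rdot (lftv l) (pt M) =
  rdot (lftv l) (lftv (val (pclass M))) + rdot (lftv l) (lftv (acoord M)) * t.
Proof.
move=> MS; rewrite /rdot big_distrl -big_split; apply: eq_bigr => i _ /=.
by rewrite (acoordP _ MS) !mxE mulrDr !mulrA.
Qed.

Lemma segval_eq l M M' : M \in S -> M' \in S -> pclass M = pclass M' ->
  inc l (pclass M) ->
  (segval l M == segval l M') = (dot (val l) (acoord M - acoord M') == 0).
Proof.
move=> MS M'S cc Il; rewrite -[segval l M]pi_lft -[segval l M']pi_lft -eq_tl.
rewrite -!segvalP -?cc // !rdot_acoord // cc (inj_eq (addrI _)) eq_tr.
exact: pi_rdot_eq.
Qed.

Let lft_step c d d' a y : pi y = c -> y = lft c + lft d' * t -> d - d' = a * c ->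
  lft c + lft d * t = y * (1 + lft a * t).
Proof.
move=> ey y_eq e; rewrite mulrDr mulr1 mulrA {1}y_eq -addrA -mulrDl.
congr (_ + _); apply/eqP; rewrite eq_tr piD piM ey 3!pi_lft.
by rewrite -(subrK d' d) e (mulrC c) addrC.
Qed.

(** A shift along the class vector only rescales the representative by [1 + lft a * t]. *)
Let sub_class M M' a : M \in S -> M' \in S -> pclass M = pclass M' ->
  acoord M - acoord M' = a *: val (pclass M') -> M \subset M'.
Proof.
move=> MS M'S cc e.
have ptM : pt M = rmul (pt M') (1 + lft a * t).
  apply/rowP => i; rewrite [RHS]mxE (acoordP i MS) cc.
  apply: (lft_step _ (acoordP i M'S)).
    by rewrite -(pi_pt M'S) mxE.
  by move/rowP/(_ i): e => e; rewrite mxE [X in _ + X]mxE in e; rewrite e mxE.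
apply/subsetP => v; rewrite {1}(ptE MS) => /imsetP[r _ ->].
rewrite (ptE M'S); apply/imsetP; exists ((1 + lft a * t) * r) => //.
by rewrite ptM; apply/rowP => i; rewrite !mxE mulrA.
Qed.

Lemma acoord_indep M M' : M \in S -> M' \in S -> pclass M = pclass M' -> M != M' ->
  \rank (col_mx (val (pclass M)) (acoord M - acoord M')) = 2%N.
Proof.
move=> MS M'S cc ne; apply: rank_col_mx2 (ppoint_neq0 _) _ => a e.
case/eqP: ne; apply/eqP; rewrite eqEsubset.
rewrite (@sub_class M M' a) -?cc // (@sub_class M' M (- a)) -?cc //.
by rewrite scaleNr -e opprB.
Qed.

(** [l] must be orthogonal to the class vector and to the difference of affine positions, which are
    independent. *)
Lemma card_dir M M' : M \in S -> M' \in S -> M != M' -> pclass M = pclass M' ->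
  #|[set l | inc (pclass M) l && (segval l M == segval l M')]| = 1%N.
Proof.
move=> MS M'S ne cc; rewrite -(card_ppoint_perp2 (acoord_indep MS M'S cc ne)).
apply: eq_card => l; rewrite !inE inc_sym.
rewrite -/(inc l (pclass M)); case: (boolP (inc l _)) => //= Il.
exact: segval_eq.
Qed.

Lemma no_parallelogram : odd #|F| -> forall M1 M2 M3 M4 l1 l2 l3,
  uniq [:: M1; M2; M3; M4] -> {subset [:: M1; M2; M3; M4] <= S} ->
  pclass M2 = pclass M1 -> pclass M3 = pclass M1 -> pclass M4 = pclass M1 ->
  inc (pclass M1) l1 -> inc (pclass M1) l2 -> inc (pclass M1) l3 ->
  segval l1 M1 = segval l1 M2 -> segval l1 M3 = segval l1 M4 ->
  segval l2 M1 = segval l2 M3 -> segval l2 M2 = segval l2 M4 ->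
  segval l3 M1 = segval l3 M4 -> segval l3 M2 = segval l3 M3 ->
  segval l1 M1 = segval l1 M3.
Proof.
move=> oF M1 M2 M3 M4 l1 l2 l3 u sub c2 c3 c4 I1 I2 I3 a1 b1 a2 b2 a3 b3.
have [e12|l12] := eqVneq l1 l2; first by rewrite e12.
have S1 : M1 \in S by apply: sub; rewrite !inE eqxx.
have S2 : M2 \in S by apply: sub; rewrite !inE eqxx ?orbT.
have S3 : M3 \in S by apply: sub; rewrite !inE eqxx ?orbT.
have S4 : M4 \in S by apply: sub; rewrite !inE eqxx ?orbT.
have dE l M M' : inc (pclass M1) l -> M \in S -> M' \in S -> pclass M = pclass M1 ->
    pclass M' = pclass M1 -> segval l M = segval l M' ->
    dot (val l) (acoord M) = dot (val l) (acoord M').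
  move=> Il MS M'S cM cM' /eqP e; apply/eqP; rewrite -subr_eq0 -dotBr.
  have Il' : inc l (pclass M) by rewrite cM inc_sym.
  by rewrite -(segval_eq MS M'S (etrans cM (esym cM')) Il').
have z3 := parallelogram (odd_card_two oF) I1 I2 I3 l12
  (dE l1 M1 M2 I1 S1 S2 erefl c2 a1) (dE l1 M3 M4 I1 S3 S4 c3 c4 b1)
  (dE l2 M1 M3 I2 S1 S3 erefl c3 a2) (dE l2 M2 M4 I2 S2 S4 c2 c4 b2)
  (dE l3 M1 M4 I3 S1 S4 erefl c4 a3) (dE l3 M2 M3 I3 S2 S3 c2 c3 b3).
(* By [z3] the direction [l3] also joins [M1] and [M2], so it equals [l1], and [M3] falls into the
   same segment. *)
have n12 : M1 != M2 by move: u; rewrite /= !inE !negb_or -!andbA => /andP[].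
have := card_dir S1 S2 n12 (esym c2) => /eqP/cards1P[k ek].
have k1 : l1 \in [set k] by rewrite -ek inE I1 a1 eqxx.
have k3 : l3 \in [set k].
  have I3' : inc l3 (pclass M1) by rewrite inc_sym.
  rewrite -ek inE I3 (segval_eq S1 S2 (esym c2) I3').
  exact/eqP.
move: k1 k3 a3 b3; rewrite !inE => /eqP <- /eqP -> a3 b3.
by rewrite a1.
Qed.

Theorem card_proj_arc_le : (5 <= #|F|)%N -> (#|S| <= bound #|F|)%N.
Proof.
move=> q5; apply: (@card_arc_le _ (ppoint F) F 'rV[F]_2 (@inc F) #|F| S pclass segval
  (@seg_form F)) => //.
- exact: inc_sym.
- exact: card_ppoint.
- exact: card_inc.
- exact: card_inc2.
- exact: card_seg_form.
- exact: arc_seg.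
- exact: card_dir.
- exact: no_parallelogram.
Qed.

End Coordinates.

(** * The order of the residue field and the bound for [m_arc] *)

Lemma card_quotient (R : finNzRingType) (F : finFieldType) (pi : R -> F) (J : {set R}) :
  {morph pi : x y / (x + y)%R} -> (forall x, (pi x == 0%R) = (x \in J)) ->
  (forall a, exists x, pi x = a) -> #|R| = #|F| * #|J|.
Proof.
move=> piD ker onto; rewrite -[LHS]sum1_card (partition_big pi xpredT) //=.
rewrite (eq_bigr (fun=> #|J|)) => [|a _]; first by rewrite sum_nat_const.
have [x <-] := onto a; have inj : injective (fun j => x + j)%R by apply: addrI.
rewrite -(card_imset J inj) -sum1_card; apply: eq_bigl => y; apply/eqP/imsetP.
  move=> e; exists (y - x)%R; last by rewrite addrC subrK.
  by rewrite -ker -(can_eq (addrK (pi x))) -piD subrK e add0r.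
by case=> j; rewrite -ker => /eqP e ->; rewrite piD e addr0.
Qed.

Theorem theorem4p12 (R : finNzRingType) (q : nat) :
  chain_ring_len2 R ->
  #|R| = (q * #|jrad R|)%N ->
  (exists p k : nat, prime p /\ q = (p ^ k)%N) ->
  (5 <= q)%N ->
  (m_arc R 3 <= (if odd q then 2 * q ^ 2 - 2 * q + 4 else 2 * q ^ 2 - q + 4))%N.
Proof.
move=> chainR cardR _ q5.
have properJ : jrad R != setT.
  have R0 : 0 < #|R| by apply/card_gt0P; exists 0%R.
  apply/eqP => e; move/eqP: cardR.
  by rewrite e cardsT -{1}[#|R|]mul1n eqn_pmul2r // => /eqP q1; rewrite -q1 in q5.
have [F [pi [piD piM ker onto]]] := residue_field (jrad0 chainR)
  (jradB chainR) (jradMr chainR) (jradMl chainR) (jrad1 chainR properJ)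
  (jrad_unit chainR).
have [t [[t0 tJ] tl tr tl0 tr0]] := jrad_generator chainR properJ.
have qF : q = #|F|.
  have J0 : 0 < #|jrad R| by apply/card_gt0P; exists 0%R; apply: jrad0.
  by apply/eqP; rewrite -(eqn_pmul2r J0) -cardR (card_quotient piD ker onto).
have [p0 _] : exists p0 : ppoint F, true.
  have : 0 < #|{: ppoint F}| by rewrite card_ppoint addn1.
  by case/card_gt0P=> p0; exists p0.
apply/bigmax_leqP => S /andP[/forallP Spt /forallP Sarc].
rewrite -/(bound q) qF; apply: (@card_proj_arc_le R F pi t) => //.
- by move=> x; rewrite ker; apply: jrad_unit.
- by apply/eqP; rewrite ker.
- by move=> x /eqP; rewrite ker; apply: tl.
- by move=> x /eqP; rewrite ker; apply: tr.
- by move=> r; rewrite tl0 ker.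
- by move=> r; rewrite tr0 ker.
- by move=> M; apply/implyP.
- by move=> L; apply/implyP.
- by rewrite -qF.
Qed.
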